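(* Let $\boldsymbol{\xi},\boldsymbol{\mu}$ be unit pure quaternions such that $(1,\boldsymbol{\xi},\boldsymbol{\mu},\boldsymbol{\xi}\boldsymbol{\mu})$ is a quaternion basis. Let $z(t)=z_r(t)+\boldsymbol{\xi}z_i(t)$, with $z_r,z_i\in L^2(\mathbb{R})$ real-valued, be an improper complex signal with values in $\mathbb{C}^{\boldsymbol{\xi}}$, and let $h(t)=z(t)+\boldsymbol{\mu}\,o(t)$, with $o(t)=o_r(t)+\boldsymbol{\xi}o_i(t)$, be its hyperanalytic signal computed using a quaternion Fourier transform with axis $\boldsymbol{\mu}$. Then $h(t)$ is $\mathbb{C}^{\boldsymbol{\mu}}$-proper, and its covariance matrix is $$ \Gamma_h=\begin{bmatrix} \alpha & \gamma & 0 & \beta\\ \gamma & \omega & \beta & 0\\ 0 & \beta & \alpha & -\gamma\\ \beta & 0 & -\gamma & \omega \end{bmatrix} $$ with $$\alpha=\int_{-\infty}^{\infty}z_r^2(t)\,\mathrm{d}t=\int_{-\infty}^{\infty}o_r^2(t)\,\mathrm{d}t,\qquad \omega=\int_{-\infty}^{\infty}z_i^2(t)\,\mathrm{d}t=\int_{-\infty}^{\infty}o_i^2(t)\,\mathrm{d}t,$$ $$\beta=\int_{-\infty}^{\infty}z_i(t)o_r(t)\,\mathrm{d}t=\int_{-\infty}^{\infty}z_r(t)o_i(t)\,\mathrm{d}t,\qquad \gamma=\int_{-\infty}^{\infty}z_r(t)z_i(t)\,\mathrm{d}t=-\int_{-\infty}^{\infty}o_r(t)o_i(t)\,\mathrm{d}t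 .$$
   Context: $\mathbb{H}$ denotes the quaternions. A unit pure quaternion is a quaternion of modulus 1 with zero scalar part; $(1,\boldsymbol{\xi},\boldsymbol{\mu},\boldsymbol{\xi}\boldsymbol{\mu})$ is a quaternion basis when the unit pure quaternions $\boldsymbol{\xi},\boldsymbol{\mu}$ are orthogonal (the scalar part of $\boldsymbol{\xi}\boldsymbol{\mu}$ is zero). $\mathbb{C}^{\boldsymbol{\xi}}=\mathbb{R}+\mathbb{R}\boldsymbol{\xi}$. For $z=z_r+\boldsymbol{\xi}z_i$, the quaternion Fourier transform with axis $\boldsymbol{\mu}$ is $Z_{\boldsymbol{\mu}}(\nu)=\mathcal{F}_{\boldsymbol{\mu}}[z](\nu)=\int_{-\infty}^{\infty}z(t)e^{-\boldsymbol{\mu}2\pi\nu t}\,\mathrm{d}t$ (extended to $L^2$ as usual), with inverse $\mathcal{F}_{\boldsymbol{\mu}}^{-1}[X](t)=\int_{-\infty}^{\infty}X(\nu)e^{\boldsymbol{\mu}2\pi\nu t}\,\mathrm{d}\nu$. The orthogonal signal is $o(t)=\mathcal{H}_{\boldsymbol{\mu}}[z](t)=\mathcal{F}_{\boldsymbol{\mu}}^{-1}[-\boldsymbol{\mu}\,\mathrm{sign}(\nu)Z_{\boldsymbol{\mu}}(\nu)](t)$; equivalently $o_r=\mathcal{H}[z_r]$ and $o_i=-\mathcal{H}[z_i]$, with $\mathcal{H}[x]=\mathrm{p.v.}\,(x*\frac{1}{\pi t})$ the classical Hilbert transform. The hyperanalytic signal of $z$ is $h(t)=z(t)+\boldsymbol{\mu}\,\mathcal{H}_{\boldsymbol{\mu}}[z](t)$.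 Properness is understood for deterministic signals. A complex signal $z=z_r+\boldsymbol{\xi}z_i$ is proper if its real and imaginary parts are orthogonal, $\int_{-\infty}^{\infty} z_rz_i\,\mathrm{d}t=0$, and have the same magnitude, $\int_{-\infty}^{\infty} z_r^2\,\mathrm{d}t=\int_{-\infty}^{\infty} z_i^2\,\mathrm{d}t$; otherwise it is improper. The covariance matrix (correlation at zero lag) $\Gamma_h$ is the real symmetric $4\times4$ matrix of the integrals $C_{xy}=\int_{-\infty}^{\infty}x(t)y(t)\,\mathrm{d}t$ with $x,y$ ranging, in this order, over $z_r,z_i,o_r,o_i$. Properness of $h$ is observed through the pattern of $\Gamma_h$: $h$ is $\mathbb{C}^{\boldsymbol{\mu}}$-proper if $\Gamma_h$ has the pattern $\begin{bmatrix} \alpha & \gamma & 0 & \beta\\ \gamma & \omega & \beta & 0\\ 0 & \beta & \alpha & -\gamma\\ \beta & 0 & -\gamma & \omega\end{bmatrix}$ for some real $\alpha,\beta,\gamma,\omega$. *)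

(* Defs.v *)
From HB Require Import structures.
From mathcomp Require Import all_boot all_order all_algebra.
From mathcomp Require Import ring.
From mathcomp Require Import all_classical all_reals all_analysis.

Set Implicit Arguments.
Unset Strict Implicit.
Unset Printing Implicit Defensive.

Import Order.TTheory GRing.Theory Num.Theory.
Import numFieldNormedType.Exports.

Local Open Scope classical_set_scope.
Local Open Scope ring_scope.

Record quat (R : realType) := Quat { qre : R; qi : R; qj : R; qk : R }.

Section QuaternionAlgebra.
Variable R : realType.
Local Notation H := (quat R).
Implicit Types (p q r : H) (a b : R).

Definition quat_tuple q : R * R * R * R := (qre q, qi q, qj q, qk q).
Definition tuple_quat (u : R * R * R * R) : H :=
  let: (a, b, c, d) := u in Quat a b c d.

Lemma quat_tupleK : cancel quat_tuple tuple_quat.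
Proof. by case. Qed.

HB.instance Definition _ := Choice.copy H (can_type quat_tupleK).

Definition quat_add p q :=
  Quat (qre p + qre q) (qi p + qi q) (qj p + qj q) (qk p + qk q).
Definition quat_opp q := Quat (- qre q) (- qi q) (- qj q) (- qk q).
Definition quat_scale a q := Quat (a * qre q) (a * qi q) (a * qj q) (a * qk q).
Definition quat_mul p q := Quat
  (qre p * qre q - qi p * qi q - qj p * qj q - qk p * qk q)
  (qre p * qi q + qi p * qre q + qj p * qk q - qk p * qj q)
  (qre p * qj q - qi p * qk q + qj p * qre q + qk p * qi q)
  (qre p * qk q + qi p * qj q - qj p * qi q + qk p * qre q).

Definition quat_zero : H := Quat 0 0 0 0.
Definition quat_one : H := Quat 1 0 0 0.

Local Ltac qring := repeat intro; congr Quat => /=; ring.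

Fact quat_addA : associative quat_add. Proof. by qring. Qed.
Fact quat_addC : commutative quat_add. Proof. by qring. Qed.
Fact quat_add0 : left_id quat_zero quat_add. Proof. by case=> *; qring. Qed.
Fact quat_addN : left_inverse quat_zero quat_opp quat_add. Proof. by qring. Qed.

HB.instance Definition _ := GRing.isZmodule.Build H quat_addA quat_addC quat_add0 quat_addN.

Fact quat_mulA : associative quat_mul. Proof. by qring. Qed.
Fact quat_1mul : left_id quat_one quat_mul. Proof. by case=> *; qring. Qed.
Fact quat_mul1 : right_id quat_one quat_mul. Proof. by case=> *; qring. Qed.
Fact quat_mulDl : left_distributive quat_mul quat_add. Proof. by qring. Qed.
Fact quat_mulDr : right_distributive quat_mul quat_add. Proof. by qring. Qed.
Fact quat_one_neq0 : quat_one != quat_zero.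
Proof. by apply/eqP => /(congr1 (@qre R)) /eqP; rewrite oner_eq0. Qed.

HB.instance Definition _ :=
  GRing.Zmodule_isNzRing.Build H quat_mulA quat_1mul quat_mul1 quat_mulDl quat_mulDr quat_one_neq0.

Fact quat_scaleA a b q : quat_scale a (quat_scale b q) = quat_scale (a * b) q.
Proof. by qring. Qed.
Fact quat_scale1 : left_id 1 quat_scale. Proof. by case=> *; qring. Qed.
Fact quat_scaleDr : right_distributive quat_scale +%R. Proof. by qring. Qed.
Fact quat_scaleDl q : {morph quat_scale^~ q : a b / a + b}.
Proof. by qring. Qed.

HB.instance Definition _ :=
  GRing.Zmodule_isLmodule.Build R H quat_scaleA quat_scale1 quat_scaleDr quat_scaleDl.

Fact quat_scaleAl a p q : a *: (p * q) = (a *: p) * q.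
Proof. by qring. Qed.

HB.instance Definition _ := GRing.Lmodule_isLalgebra.Build R H quat_scaleAl.

Fact quat_scaleAr a p q : a *: (p * q) = p * (a *: q).
Proof. by qring. Qed.

HB.instance Definition _ := GRing.Lalgebra_isAlgebra.Build R H quat_scaleAr.

Definition quat_conj q : H := Quat (qre q) (- qi q) (- qj q) (- qk q).

Definition quat_norm q : R :=
  Num.sqrt (qre q ^+ 2 + qi q ^+ 2 + qj q ^+ 2 + qk q ^+ 2).

Definition unit_pure q := quat_norm q = 1 /\ qre q = 0.

Definition quaternion_basis (xi mu : H) :=
  [/\ unit_pure xi, unit_pure mu & qre (xi * mu) = 0].

(* e^{mu theta}; this closed form (Euler's) presupposes mu ^+ 2 = -1, which
   holds for unit pure mu. *)
Definition quat_exp (mu : H) (theta : R) : H := (cos theta)%:A + sin theta *: mu.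

(* Coordinate of q along u, for u an element of an orthonormal basis of the
   quaternions viewed as R^4. *)
Definition quat_coord u q : R := qre (quat_conj u * q).

End QuaternionAlgebra.

Section QuaternionFourier.
Variable R : realType.
Local Notation H := (quat R).
Local Notation leb := (@lebesgue_measure R).
Implicit Types (f g z o h : R -> H) (xi mu : H).

Definition quat_integral f : H :=
  Quat (\int[leb]_t qre (f t)) (\int[leb]_t qi (f t))
       (\int[leb]_t qj (f t)) (\int[leb]_t qk (f t)).

Definition quat_Lfun (p : \bar R) f :=
  [/\ (fun t => qre (f t)) \in Lfun leb p, (fun t => qi (f t)) \in Lfun leb p,
      (fun t => qj (f t)) \in Lfun leb p & (fun t => qk (f t)) \in Lfun leb p].

Definition L2_cvg (f_ : nat -> R -> H) f :=
  (\int[leb]_t (quat_norm (f_ n t - f t) ^+ 2)%:E)%E @[n --> \oo] --> 0%E.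

(* The exponential kernel multiplies on the right. *)
Definition qft_int mu z (nu : R) : H :=
  quat_integral (fun t => z t * quat_exp mu (- (2 * pi * nu * t))).

Definition iqft_int mu z (t : R) : H :=
  quat_integral (fun nu => z nu * quat_exp mu (2 * pi * nu * t)).

(* g is the image of f under the extension to L^2, by density and continuity,
   of the operator F given on the intersection of L^1 and L^2. As usual g is
   determined only up to almost everywhere equality. *)
Definition L2_extension (F : (R -> H) -> R -> H) f g :=
  [/\ quat_Lfun 2%:E f, quat_Lfun 2%:E g &
      exists f_ : nat -> R -> H,
        [/\ forall n, quat_Lfun 1%:E (f_ n) /\ quat_Lfun 2%:E (f_ n),
            L2_cvg f_ f & L2_cvg (fun n => F (f_ n)) g]].

Definition is_qft mu := L2_extension (qft_int mu).
Definition is_iqft mu := L2_extension (iqft_int mu).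

Definition is_orthogonal_signal mu z o :=
  exists Z : R -> H,
    is_qft mu z Z /\ is_iqft mu (fun nu => Num.sg nu *: (- mu * Z nu)) o.

Definition is_hyperanalytic_signal mu z o h :=
  is_orthogonal_signal mu z o /\ forall t, h t = z t + mu * o t.

Definition complex_signal xi (x y : R -> R) (t : R) : H :=
  (x t)%:A + xi * (y t)%:A.

Definition proper_signal (x y : R -> R) :=
  \int[leb]_t (x t * y t) = 0 /\ \int[leb]_t (x t ^+ 2) = \int[leb]_t (y t ^+ 2).

(* The covariance matrix of the components of h along 1, xi, mu, mu xi. For
   h = (z_r + xi z_i) + mu (o_r + xi o_i) these are z_r, z_i, o_r, o_i, in
   this order; note that the last basis element is mu xi = - xi mu. *)
Definition covariance_mx xi mu h : 'M[R]_4 :=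
  let e (i : 'I_4) := tnth [tuple 1; xi; mu; mu * xi] i in
  \matrix_(i, j) \int[leb]_t (quat_coord (e i) (h t) * quat_coord (e j) (h t)).

Definition Cmu_pattern (alpha beta gamma omega : R) : 'M[R]_4 :=
  \matrix_(i, j) nth 0 (nth [::] [::
    [:: alpha; gamma; 0;       beta];
    [:: gamma; omega; beta;    0];
    [:: 0;     beta;  alpha;   - gamma];
    [:: beta;  0;     - gamma; omega]] i) j.

Definition Cmu_proper xi mu h :=
  exists alpha beta gamma omega : R,
    covariance_mx xi mu h = Cmu_pattern alpha beta gamma omega.

End QuaternionFourier.

(* Main.v *)
Require Import Defs.
From HB Require Import structures.
From mathcomp Require Import all_boot all_order all_algebra.
From mathcomp Require Import ring lra.
From mathcomp Require Import all_classical all_reals all_analysis.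
From mathcomp Require Import measurable_realfun.

Set Implicit Arguments.
Unset Strict Implicit.
Unset Printing Implicit Defensive.

Import Order.TTheory GRing.Theory Num.Theory.
Import numFieldNormedType.Exports.

Local Open Scope classical_set_scope.
Local Open Scope ring_scope.

(* Right multiplication by e^{-mu theta} mixes only the coordinates along u and
   u mu, so for u = 1 and u = xi the quaternion Fourier transform is an ordinary
   complex Fourier transform of a pair of real functions. If Z0, Z1, Z2, Z3 are
   the coordinates of Z along 1, xi, mu, xi mu, then those of - mu sign(nu) Z
   are sign(nu) times Z2, - Z3, - Z0, Z1. Parseval's identity, for the direct
   and for the inverse transform, then yields alpha, omega and gamma, while beta
   and the zeros of the matrix follow from the adjointness of the direct and
   inverse transforms, which is Fubini's theorem: no inversion formula is needed.

   Plancherel's identity for f in L^1 and L^2: the power spectrum of f is the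
   cosine transform of its autocorrelation r, hence its Abel means are Poisson
   means of r, which tend to r(0), the integral of f^2, because r is continuous
   at 0. *)

(** [L2_extension] is a relation that provides some approximating sequence, and the sequences behind
    Z and behind o are unrelated. Each identity is therefore a bilinear one, proved on L^1 and L^2
    and carried to the limit by continuity of the inner product, with separate sequences for its two
    sides. Adjointness links z to o: since o is the inverse transform of W = - mu sign(nu) Z, the
    pairing of z with o is that of Z with W, which is algebra in the coordinates of Z. Left
    multiplication by mu turns the pairs (1, mu) and (xi, xi mu) in opposite senses, because xi and
    mu anticommute; hence the equality of the two integrals for beta and the sign of - gamma. Abel
    weights are used because integrability of the power spectrum is not known beforehand: they
    increase to 1, so monotone convergence yields integrability and value together. Continuity of r
    at 0 comes from approximating f in L^2 by bounded functions that are continuous almost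
    everywhere. *)

Section Integration.

(** * Real Lebesgue integrals: dominated convergence, Fubini's theorem, changes of variable *)

Variable R : realType.
Local Notation leb := (@lebesgue_measure R).
Implicit Types f g h : R -> R.

Definition L1 f := leb.-integrable setT (EFin \o f).

(** Measurability of [f] is a separate conjunct, since that of its square does not imply it. *)
Definition L2 f := measurable_fun setT f /\ L1 (fun x => f x ^+ 2).

Lemma L1_measurable f : L1 f -> measurable_fun setT f.
Proof. by move=> /integrableP[/measurable_EFinP]. Qed.

Lemma L1_le f g : measurable_fun setT f -> (forall x, `|f x| <= g x) ->
  L1 g -> L1 f.
Proof.
move=> mf fg; apply: le_integrable => //; first exact/measurable_EFinP.
by move=> x _; rewrite /= lee_fin (le_trans (fg x))// ler_norm.
Qed.

Lemma L1D f g : L1 f -> L1 g -> L1 (fun x => f x + g x).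
Proof. by move=> Lf Lg; exact: (integrableD measurableT Lf Lg). Qed.

Lemma L1N f : L1 f -> L1 (fun x => - f x).
Proof. by move=> Lf; exact: (integrableN Lf). Qed.

Lemma L1B f g : L1 f -> L1 g -> L1 (fun x => f x - g x).
Proof. by move=> Lf Lg; apply: L1D => //; exact: L1N. Qed.

Lemma L1Z a f : L1 f -> L1 (fun x => a * f x).
Proof. by move=> Lf; exact: (integrableZl measurableT a Lf). Qed.

Lemma L1_norm f : L1 f -> L1 (fun x => `|f x|).
Proof. exact: integrable_norm. Qed.

Lemma L1Mbounded f h M : L1 f -> measurable_fun setT h ->
  (forall x, `|h x| <= M) -> L1 (fun x => f x * h x).
Proof.
move=> Lf mh hM; apply: (@L1_le _ (fun x => M * `|f x|)).
- by apply: measurable_funM => //; exact: L1_measurable.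
- by move=> x; rewrite normrM mulrC ler_wpM2r.
- exact/L1Z/L1_norm.
Qed.

Lemma L2M f g : L2 f -> L2 g -> L1 (fun x => f x * g x).
Proof.
move=> [mf Lf] [mg Lg]; apply: (@L1_le _ (fun x => f x ^+ 2 + g x ^+ 2)).
- exact: measurable_funM.
- move=> x; rewrite normrM -(real_normK (num_real (f x))).
  rewrite -(real_normK (num_real (g x))).
  have := sqr_ge0 (`|f x| - `|g x|); rewrite sqrrB => H.
  have := normr_ge0 (f x); have := normr_ge0 (g x); nra.
- exact: L1D.
Qed.

Lemma L2D f g : L2 f -> L2 g -> L2 (fun x => f x + g x).
Proof.
move=> Lf Lg; split; first by apply: measurable_funD; [case: Lf|case: Lg].
have -> : (fun x => (f x + g x) ^+ 2) =
    (fun x => f x ^+ 2 + (2 * (f x * g x) + g x ^+ 2)) by apply/funext => x; ring.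
by apply: L1D; [case: Lf|apply: L1D; [exact/L1Z/L2M|case: Lg]].
Qed.

Lemma L2Mbounded f h M : L2 f -> measurable_fun setT h ->
  (forall x, `|h x| <= M) -> L2 (fun x => h x * f x).
Proof.
move=> [mf Lf] mh hM; split; first exact: measurable_funM.
under eq_fun do rewrite exprMn mulrC.
apply: (@L1Mbounded _ _ (M ^+ 2)) => //; first exact: measurable_funX.
by move=> x; rewrite normrX lerXn2r// ?nnegrE// (le_trans _ (hM x)).
Qed.

Lemma L2Z a f : L2 f -> L2 (fun x => a * f x).
Proof. by move=> Lf; apply: (@L2Mbounded _ _ `|a|). Qed.

Lemma L2N f : L2 f -> L2 (fun x => - f x).
Proof. by under eq_fun do rewrite -mulN1r; exact: L2Z. Qed.

Lemma L2B f g : L2 f -> L2 g -> L2 (fun x => f x - g x).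
Proof. by move=> Lf Lg; apply: L2D => //; exact: L2N. Qed.

Lemma L2_Lfun f : f \in Lfun leb 2%:E -> L2 f.
Proof.
move=> Lf; split; last exact: Lfun2_integrable_sqr.
by move: Lf; rewrite inE => /andP[/[!inE]].
Qed.

Lemma le_RintegralT f g : L1 f -> L1 g -> (forall x, f x <= g x) ->
  \int[leb]_x f x <= \int[leb]_x g x.
Proof. by move=> Lf Lg fg; apply: le_Rintegral. Qed.

Lemma EFin_Rintegral f : L1 f ->
  (\int[leb]_x f x)%:E = (\int[leb]_x (f x)%:E)%E.
Proof. by move=> Lf; rewrite fineK//; exact: integrable_fin_num. Qed.

Lemma L1_fin_integral f : measurable_fun setT f -> (forall x, 0 <= f x) ->
  (\int[leb]_x (f x)%:E < +oo)%E -> L1 f.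
Proof.
move=> mf f0 foo; apply/integrableP; split; first exact/measurable_EFinP.
by under eq_integral do rewrite /= ger0_norm//.
Qed.

Lemma ae_leb_sub (P Q : R -> Prop) : (forall x, P x -> Q x) ->
  {ae leb, forall x, P x} -> {ae leb, forall x, Q x}.
Proof. by move=> PQ; apply: negligibleS; exact: subsetC. Qed.

Lemma dominated_convergence_R (u : nat -> R -> R) f G :
  (forall n, measurable_fun setT (u n)) -> measurable_fun setT f ->
  {ae leb, forall x, u ^~ x @ \oo --> f x} ->
  L1 G -> (forall n x, `|u n x| <= G x) ->
  \int[leb]_x u n x @[n --> \oo] --> \int[leb]_x f x.
Proof.
move=> mu mf uf LG uG.
have Lu n : L1 (u n) by apply: L1_le LG.
have umu n : measurable_fun setT (EFin \o u n) by exact/measurable_EFinP.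
have mf' : measurable_fun setT (EFin \o f) by exact/measurable_EFinP.
have ae1 : {ae leb, forall x, setT x -> (EFin \o u n) x @[n --> \oo] --> (EFin \o f) x}.
  apply: ae_leb_sub uf => x ux _; apply: cvg_EFin => //; exact: nearW.
have ae2 : {ae leb, forall x n, setT x -> (`|(EFin \o u n) x| <= (EFin \o G) x)%E}.
  by apply: aeW => x n _; rewrite /= lee_fin.
have [Lf _] := @dominated_convergence _ _ R leb setT measurableT
    (fun n => EFin \o u n) _ _ umu mf' ae1 LG ae2.
by move=> H; apply: fine_cvg; rewrite EFin_Rintegral.
Qed.

(** By Tonelli's theorem the double integral of |F| is at most the product of the L^1 norms of [g]
    and [h]. The transforms meet such a bound because their kernel is bounded by 1. *)
Lemma integrable_prod_dominated (F : R * R -> R) (g h : R -> R) :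
  measurable_fun setT F -> L1 g -> L1 h ->
  (forall x y, `|F (x, y)| <= g x * h y) ->
  (leb \x leb)%E.-integrable setT (EFin \o F).
Proof.
move=> mF Lg Lh Fgh.
apply/integrable12ltyP; first exact/measurable_EFinP.
have mEn : measurable_fun setT (fun y : R => `|h y|%:E).
  by apply/measurable_EFinP; apply: measurableT_comp => //; exact: L1_measurable.
have h0 : 0 <= \int[leb]_x `|h x| by apply: Rintegral_ge0.
apply: (@le_lt_trans _ _ (\int[leb]_x (`|g x| * \int[leb]_y `|h y|)%:E)%E); last first.
  rewrite -EFin_Rintegral ?ltry//; under eq_fun do rewrite mulrC.
  exact/L1Z/L1_norm.
apply: ge0_le_integral => //.
- by move=> x _; exact: integral_ge0.
- have mF' : measurable_fun setT (fun z : R * R => `|(F z)%:E|)%E.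
    by apply: measurableT_comp => //; exact/measurable_EFinP.
  exact: (@measurable_fun_fubini_tonelli_F _ _ (measurableTypeR R)
    (measurableTypeR R) R leb _ mF').
- apply/measurable_EFinP; apply: measurable_funM => //.
  by apply: measurableT_comp => //; exact: L1_measurable.
- move=> x _; rewrite EFinM EFin_Rintegral; last exact: L1_norm.
  rewrite -ge0_integralZl//.
  apply: ge0_le_integral => //.
  + apply: measurableT_comp => //; apply/measurable_EFinP.
    exact: measurable_fun_pair2 mF.
  + by apply: emeasurable_funM => //; refine mEn.
  + move=> y _; rewrite -EFinM lee_fin (le_trans (Fgh x y))//.
    by rewrite -normrM ler_norm.
Qed.

Section FubiniR.
Variable F : R * R -> R.
Hypothesis iF : (leb \x leb)%E.-integrable setT (EFin \o F).
Hypothesis F1 : forall x, L1 (fun y => F (x, y)).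

(** [Rintegral] applies [fine], which sends an infinite integral to 0; with every section
    integrable, the inner real integral agrees with the extended one. *)
Lemma L1_Rintegral_section : L1 (fun x => \int[leb]_y F (x, y)).
Proof.
have := integrable_fubini_F iF.
congr (leb.-integrable _ _); apply/funext => x.
by rewrite /= EFin_Rintegral.
Qed.

Hypothesis F2 : forall y, L1 (fun x => F (x, y)).

Lemma Rintegral_Fubini :
  \int[leb]_x \int[leb]_y F (x, y) = \int[leb]_y \int[leb]_x F (x, y).
Proof.
have FF := Fubini iF.
rewrite /Rintegral; congr fine.
under eq_integral do rewrite -/(Rintegral leb setT (fun y => F (_, y))) EFin_Rintegral//.
under [RHS]eq_integral do
  rewrite -/(Rintegral leb setT (fun x => F (x, _))) EFin_Rintegral//.
exact: FF.
Qed.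

End FubiniR.

Lemma eq_RintegralT f g : f =1 g -> \int[leb]_x f x = \int[leb]_x g x.
Proof. by move=> fg; apply: eq_Rintegral => x _. Qed.

Lemma RintegralDT f g : L1 f -> L1 g ->
  \int[leb]_x (f x + g x) = \int[leb]_x f x + \int[leb]_x g x.
Proof. by move=> Lf Lg; rewrite RintegralD. Qed.

Lemma RintegralBT f g : L1 f -> L1 g ->
  \int[leb]_x (f x - g x) = \int[leb]_x f x - \int[leb]_x g x.
Proof. by move=> Lf Lg; rewrite RintegralB. Qed.

Lemma RintegralZT a f : L1 f ->
  \int[leb]_x (a * f x) = a * \int[leb]_x f x.
Proof. by move=> Lf; rewrite RintegralZl. Qed.

Lemma RintegralNT f : L1 f -> \int[leb]_x (- f x) = - \int[leb]_x f x.
Proof.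
by move=> Lf; under eq_Rintegral do rewrite -mulN1r; rewrite RintegralZT// mulN1r.
Qed.

Lemma measurable_affine (a s : R) : measurable_fun setT (fun v : R => s + a * v).
Proof. by apply: measurable_funD => //; exact: measurable_funM. Qed.

(** Lebesgue measure is determined by half-open intervals; the preimage of one under v |-> s + a v
    is 1/a times as long, which the factor [a] makes up for. *)
Lemma lebesgue_measure_affine (a s : R) (a0 : 0 < a) (A : set R) : measurable A ->
  pushforward (mscale (NngNum (ltW a0)) leb)
    (fun v : measurableTypeR R => s + a * v : measurableTypeR R) A = leb A.
Proof.
move=> mA; apply/esym/lebesgue_measure_unique => //=.
  exact: measurable_affine.
move=> _ _ [[x y] _ <-].
transitivity (a%:E * leb `]((x - s) / a)%R, ((y - s) / a)%R]%classic)%E; last first.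
  rewrite /pushforward /mscale /=; congr (_ * leb _)%E.
  apply/seteqP; split => v; rewrite /= !in_itv/= ltr_pdivrMr// ler_pdivlMr//.
    by move=> /andP[h1 h2]; apply/andP; split; lra.
  by move=> /andP[h1 h2]; apply/andP; split; lra.
rewrite !lebesgue_measure_itv/= !lte_fin ltr_pM2r ?invr_gt0// ltrD2r.
case: ifPn => _; last by rewrite mule0.
by rewrite -!EFinB -EFinM; congr EFin; field; rewrite gt_eqF.
Qed.

Lemma ge0_integral_affine (a s : R) f : 0 < a -> measurable_fun setT f ->
  (forall x, 0 <= f x) ->
  (\int[leb]_x (f x)%:E = a%:E * \int[leb]_v (f (s + a * v))%:E)%E.
Proof.
move=> a0 mf f0; have mf' : measurable_fun setT (EFin \o f) by exact/measurable_EFinP.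
have mphi : measurable_fun setT (fun v : measurableTypeR R => s + a * v : measurableTypeR R).
  exact: measurable_affine.
transitivity (\int[pushforward (mscale (NngNum (ltW a0)) leb)
    (fun v : measurableTypeR R => (s + a * v)%R : measurableTypeR R)]_x (f x)%:E)%E.
  apply: eq_measure_integral => A mA _; exact/esym/lebesgue_measure_affine.
rewrite ge0_integral_pushforward//; last first.
  by move=> x _; rewrite /= lee_fin.
rewrite preimage_setT.
have mg : measurable_fun setT (fun v : R => (f (s + a * v))%:E).
  by apply/measurable_EFinP; apply: (measurableT_comp mf); exact: measurable_affine.
by rewrite ge0_integral_mscale// => x _; rewrite /= lee_fin.
Qed.

Lemma L1_affine (a s : R) f : 0 < a -> L1 f -> L1 (fun v => f (s + a * v)).
Proof.
move=> a0 /integrableP[/measurable_EFinP mf foo]; apply/integrableP; split.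
  apply/measurable_EFinP; apply: (measurableT_comp mf); exact: measurable_affine.
move: foo; under eq_integral do rewrite abse_EFin.
rewrite (ge0_integral_affine s a0)//; last exact: measurableT_comp.
rewrite /=; case: (\int[_]_v _)%E => [r _| |//]; first exact: ltry.
by rewrite gt0_muley ?lte_fin// ltxx.
Qed.

Lemma Rintegral_affine (a s : R) f : 0 < a -> L1 f ->
  \int[leb]_x f x = a * \int[leb]_v f (s + a * v).
Proof.
move=> a0 Lf.
have ge0 g : L1 g -> (forall x, 0 <= g x) ->
    \int[leb]_x g x = a * \int[leb]_v g (s + a * v).
  move=> Lg g0; rewrite /Rintegral (ge0_integral_affine s a0)//.
    by rewrite fineM//; apply: integrable_fin_num => //; exact: L1_affine.
  exact: L1_measurable.
(* The positive and negative parts, (|f| + f) / 2 and (|f| - f) / 2, reduce the signed case to the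
   nonnegative one. *)
have Lp : L1 (fun x => (`|f x| + f x) / 2).
  by under eq_fun do rewrite mulrC; apply: L1Z; apply: L1D => //; exact: L1_norm.
have Ln : L1 (fun x => (`|f x| - f x) / 2).
  by under eq_fun do rewrite mulrC; apply: L1Z; apply: L1B => //; exact: L1_norm.
pose p x := (`|f x| + f x) / 2; pose n x := (`|f x| - f x) / 2.
have fE : f =1 (fun x => p x - n x) by move=> x; rewrite /p /n; field.
have Lp' := L1_affine s a0 Lp; have Ln' := L1_affine s a0 Ln.
rewrite (eq_RintegralT fE) (RintegralBT Lp Ln).
rewrite (ge0 p Lp); last by move=> x; rewrite /p; have := lerNnormlW (lexx `|f x|); lra.
rewrite (ge0 n Ln); last by move=> x; rewrite /n; have := ler_norm (f x); lra.
rewrite -mulrBr -(RintegralBT Lp' Ln'); congr (_ * _).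
by apply: eq_RintegralT => x; rewrite -fE.
Qed.

Lemma ge0_integral_opp f : measurable_fun setT f -> (forall x, 0 <= f x) ->
  (\int[leb]_x (f x)%:E = \int[leb]_v (f (- v))%:E)%E.
Proof.
move=> mf f0; have mf' : measurable_fun setT (EFin \o f) by exact/measurable_EFinP.
transitivity (\int[pushforward leb
    (-%R : measurableTypeR R -> measurableTypeR R)]_x (f x)%:E)%E.
  apply: eq_measure_integral => A mA _; exact/esym/lebesgue_measureN.
by rewrite ge0_integral_pushforward ?preimage_setT// => x _; rewrite /= lee_fin.
Qed.

End Integration.

(** * The Abel kernel, its cosine transform and the Poisson kernel *)

Section Kernel.
Variable R : realType.
Local Notation leb := (@lebesgue_measure R).
Implicit Types f g h : R -> R.

Definition abel_kernel (e x : R) : R := expR (- (e * `|x|)).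

Lemma continuous_abel_kernel e : continuous (abel_kernel e).
Proof.
move=> x; apply: continuous_comp; last exact: continuous_expR.
apply: cvgN; apply: cvgM; first exact: cvg_cst.
exact: norm_continuous.
Qed.

Lemma continuous_cosM (a : R) : continuous (fun x => cos (a * x)).
Proof.
move=> x; apply: continuous_comp; last exact: continuous_cos.
by apply: cvgM; [exact: cvg_cst|exact: cvg_id].
Qed.

Lemma cvgy_expRN (e : R) : 0 < e -> expR (- (e * x)) @[x --> +oo] --> (0 : R).
Proof.
move=> e0; apply: (cvg_comp (fun x => e * x) (fun x => expR (- x))); last exact: cvgr_expR.
exact: gt0_cvgMry.
Qed.

(** The antiderivative of e^{-ex} (1 + cos (ax)) that vanishes at +oo. Adding 1 to the cosine keeps
    the integrand nonnegative, as the fundamental theorem of calculus on a half-line used below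
    requires. *)
Let prim (e a x : R) : R :=
  expR (- (e * x)) * ((a * sin (a * x) - e * cos (a * x)) / (e ^+ 2 + a ^+ 2) - e^-1).

Let is_derive_prim (e a x : R) : 0 < e ->
  is_derive x 1 (prim e a) (expR (- (e * x)) * (1 + cos (a * x))).
Proof.
move=> e0; have ea : e ^+ 2 + a ^+ 2 != 0 by rewrite gt_eqF// ltr_pwDl ?sqr_ge0// exprn_gt0.
rewrite /prim; apply: is_derive_eq.
rewrite /GRing.scale /=; field.
by rewrite ea gt_eqF.
Qed.

Let cvgy_prim e a : 0 < e -> prim e a x @[x --> +oo] --> (0 : R).
Proof.
move=> e0; have ea : 0 < e ^+ 2 + a ^+ 2 by rewrite ltr_pwDl ?sqr_ge0// exprn_gt0.
pose M := (`|a| + e) / (e ^+ 2 + a ^+ 2) + e^-1.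
apply/cvgr0Pnorm_le => d d0.
have : M * expR (- (e * x)) @[x --> +oo] --> M * 0.
  by apply: cvgM; [exact: cvg_cst|exact: cvgy_expRN].
rewrite mulr0 => /cvgr0Pnorm_le/(_ _ d0); apply: filterS => x.
apply: le_trans; rewrite /prim !normrM mulrC ler_wpM2r//.
rewrite [leRHS]ger0_norm; last by rewrite /M addr_ge0 ?divr_ge0 ?addr_ge0 ?invr_ge0 ?sqr_ge0 ?(ltW e0).
rewrite (le_trans (ler_normB _ _))// /M normrM [`|e^-1|]gtr0_norm ?invr_gt0//.
rewrite lerD2r [`|_^-1|]gtr0_norm ?invr_gt0// ler_pM2r ?invr_gt0//.
rewrite (le_trans (ler_normB _ _))// !normrM [`|e|]gtr0_norm// lerD//.
  by rewrite ler_piMr ?sin_max.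
by rewrite ler_piMr ?cos_max ?ltW.
Qed.

Lemma integral_abel_kernel_1Dcos e a : 0 < e ->
  (\int[leb]_x (abel_kernel e x * (1 + cos (a * x)))%:E =
   (2 * (e^-1 + e / (e ^+ 2 + a ^+ 2)))%:E)%E.
Proof.
move=> e0; have cG : continuous (fun x => abel_kernel e x * (1 + cos (a * x))).
  move=> x; apply: cvgM; first exact: continuous_abel_kernel.
  by apply: cvgD; [exact: cvg_cst|exact: continuous_cosM].
rewrite ge0_symfun_integralT//; last 2 first.
- by move=> x; rewrite mulr_ge0 ?expR_ge0// -lerBlDl sub0r cos_geN1.
- by move=> x /=; rewrite /abel_kernel normrN mulrN cosN.
rewrite -set_itvcy EFinM; congr (_ * _)%E.
transitivity (\int[leb]_(x in `[0%R, +oo[) (expR (- (e * x)) * (1 + cos (a * x)))%:E)%E.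
  apply: eq_integral => x; rewrite inE/= in_itv/= andbT => x0.
  by rewrite /abel_kernel ger0_norm.
rewrite (@ge0_continuous_FTC2y _ _ (prim e a) _ 0).
- rewrite /prim mulr0 oppr0 expR0 mulr0 sin0 cos0 -EFinB; congr EFin.
  by field; rewrite !gt_eqF// ltr_pwDl ?sqr_ge0// exprn_gt0.
- by move=> x _; rewrite mulr_ge0 ?expR_ge0// -lerBlDl sub0r cos_geN1.
- apply: continuous_subspaceT => x; apply: cvgM.
    apply: continuous_comp; last exact: continuous_expR.
    by apply: cvgN; apply: cvgM; [exact: cvg_cst|exact: cvg_id].
  by apply: cvgD; [exact: cvg_cst|exact: continuous_cosM].
- exact: cvgy_prim.
- by move=> x _; have [] := is_derive_prim a x e0.
- apply: cvg_at_right_filter; apply: differentiable_continuous.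
  by apply/derivable1_diffP; have [] := is_derive_prim a 0 e0.
- by move=> x _; rewrite derive1E; have [_ ->] := is_derive_prim a x e0.
Qed.

Lemma L1_abel_kernel e : 0 < e -> L1 (abel_kernel e).
Proof.
(* At a = 0 the integrand is twice the Abel kernel. *)
move=> e0; have := integral_abel_kernel_1Dcos 0 e0.
under eq_integral do rewrite mul0r cos0 mulrC.
move=> I2; have : L1 (fun x => (1 + 1) * abel_kernel e x).
  apply: L1_fin_integral; last by rewrite I2 ltry.
    apply: measurable_funM => //; apply: continuous_measurable_fun.
    exact: continuous_abel_kernel.
  by move=> x; rewrite mulr_ge0 ?expR_ge0.
move=> /(L1Z 2^-1); congr (L1 _); apply/funext => x; by lra.
Qed.

Lemma Rintegral_abel_kernel_cos e a : 0 < e ->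
  \int[leb]_x (abel_kernel e x * cos (a * x)) = 2 * e / (e ^+ 2 + a ^+ 2).
Proof.
move=> e0; have Lk := L1_abel_kernel e0.
have ea b : e ^+ 2 + b ^+ 2 != 0.
  by rewrite gt_eqF// ltr_pwDl ?sqr_ge0// exprn_gt0.
have Lc b : L1 (fun x => abel_kernel e x * cos (b * x)).
  apply: (@L1Mbounded _ _ _ 1) => //; last by move=> x; rewrite ler_norml cos_geN1 cos_le1.
  by apply: continuous_measurable_fun; exact: continuous_cosM.
have E b : \int[leb]_x abel_kernel e x + \int[leb]_x (abel_kernel e x * cos (b * x))
    = 2 * (e^-1 + e / (e ^+ 2 + b ^+ 2)).
  rewrite -RintegralDT//; apply: EFin_inj; rewrite -integral_abel_kernel_1Dcos//.
  rewrite EFin_Rintegral; last exact: L1D.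
  by apply: eq_integral => x _; rewrite mulrDr mulr1.
pose k := \int[leb]_x abel_kernel e x.
have c0 : \int[leb]_x (abel_kernel e x * cos (0 * x)) = k.
  by apply: eq_RintegralT => x; rewrite mul0r cos0 mulr1.
(* The mass [k] of the kernel, to be subtracted from the value at a, is half the value at 0. *)
have := E 0; rewrite c0 -/k expr0n addr0 => Ek; have := E a; rewrite -/k => Ea.
have {}Ek : k = 2 / e.
  have : k + k = 2 * (2 / e) by rewrite Ek; field; rewrite gt_eqF.
  lra.
have -> : \int[leb]_x (abel_kernel e x * cos (a * x)) =
  2 * (e^-1 + e / (e ^+ 2 + a ^+ 2)) - k by rewrite -Ea addrC addKr.
by rewrite Ek; field; rewrite ea gt_eqF.
Qed.

(** The value at x of [cos_transform] of [abel_kernel 1]; it is the Cauchy density of scale 1 / (2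
    pi). *)
Definition poisson_kernel (x : R) : R := 2 / (1 + (2 * pi * x) ^+ 2).

Lemma poisson_kernel_ge0 x : 0 <= poisson_kernel x.
Proof. by rewrite divr_ge0// addr_ge0 ?sqr_ge0. Qed.

Lemma L1_poisson_kernel_integral :
  L1 poisson_kernel /\ \int[leb]_x poisson_kernel x = 1.
Proof.
have c1 := @continuous_oneDsqrV R.
have I1 : (\int[leb]_x ((oneDsqr x)^-1)%:E = pi%:E)%E.
  rewrite ge0_symfun_integralT//.
    by rewrite -set_itvcy integral0y_oneDsqr -EFinM; congr EFin; field.
  by move=> x; rewrite /= /oneDsqr sqrrN.
have L : L1 (fun x : R => (oneDsqr x)^-1).
  apply: (@L1_fin_integral R); last by rewrite I1 ltry.
    exact: continuous_measurable_fun.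
  by move=> x; rewrite invr_ge0.
have pi2 : 0 < 2 * pi :> R by rewrite mulr_gt0// pi_gt0.
have La := L1_affine 0 pi2 L.
have pE : poisson_kernel = (fun x => 2 * (oneDsqr (0 + 2 * pi * x))^-1).
  by apply/funext => x; rewrite /poisson_kernel /oneDsqr add0r.
split; first by rewrite pE; exact: L1Z.
rewrite pE RintegralZT//; have := Rintegral_affine 0 pi2 L.
rewrite {1}/Rintegral I1 /= => /eqP.
rewrite -mulrA mulrCA -subr_eq0 -[X in X - _]mulr1 -mulrBr mulf_eq0 gt_eqF ?pi_gt0//=.
by rewrite subr_eq0 => /eqP.
Qed.

End Kernel.

(** * Density of bounded, almost everywhere continuous functions; continuity of the autocorrelation
    at 0 *)

Section Density.
Variable R : realType.
Local Notation leb := (@lebesgue_measure R).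
Implicit Types f g h : R -> R.

Lemma L1_shift u f : L1 f -> L1 (fun s => f (s + u)).
Proof.
move=> Lf; have := L1_affine u ltr01 Lf; congr L1.
by apply/funext => s; rewrite mul1r addrC.
Qed.

Lemma Rintegral_shift u f : L1 f -> \int[leb]_s f (s + u) = \int[leb]_s f s.
Proof.
move=> Lf; rewrite (Rintegral_affine u ltr01 Lf) mul1r.
by apply: eq_RintegralT => s; rewrite mul1r addrC.
Qed.

Lemma measurable_shift (u : R) f : measurable_fun setT f ->
  measurable_fun setT (fun s : R => f (s + u)).
Proof. by move=> mf; apply: (measurableT_comp mf); exact: measurable_funD. Qed.

Lemma L2_shift u f : L2 f -> L2 (fun s => f (s + u)).
Proof. by move=> [mf Lf]; split; [exact: measurable_shift|exact: (L1_shift u Lf)]. Qed.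

(** Young's inequality 2 a b <= l a^2 + b^2 / l under the integral. The free weight [l] does the
    work of Cauchy-Schwarz: it first makes the term of a fixed function small, and then the other
    function has to be small relative to [l]. *)
Lemma Rintegral_mul_le f k (l : R) : L2 f -> L2 k -> 0 < l ->
  `|\int[leb]_x (f x * k x)| <=
  (l * \int[leb]_x (f x ^+ 2) + l^-1 * \int[leb]_x (k x ^+ 2)) / 2.
Proof.
move=> Lf Lk l0; have Lfk := L2M Lf Lk.
have [[mf Lf2] [mk Lk2]] := (Lf, Lk).
apply: (le_trans (le_normr_Rintegral measurableT Lfk)).
have Lr := L1D (L1Z l Lf2) (L1Z l^-1 Lk2).
rewrite -!RintegralZT// -RintegralDT//; [|exact: L1Z|exact: L1Z].
rewrite mulrC -(RintegralZT _ Lr); apply: le_RintegralT.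
- exact: L1_norm.
- exact: L1Z.
move=> x; rewrite normrM -(real_normK (num_real (f x))) -(real_normK (num_real (k x))).
move: `|f x| `|k x| => a b; rewrite -subr_ge0.
have -> : 2^-1 * (l * a ^+ 2 + l^-1 * b ^+ 2) - a * b = (2 * l)^-1 * (l * a - b) ^+ 2.
  by field; rewrite gt_eqF.
by rewrite mulr_ge0 ?sqr_ge0// invr_ge0 mulr_ge0// ltW.
Qed.

(** A sharp cut-off of a continuous function to an interval may jump at the endpoints but keeps this
    property, and it is the form of continuity that dominated convergence uses. *)
Definition ae_continuous g := {ae leb, forall x, g y @[y --> x] --> g x}.

Let truncation_set f (n : nat) : set R :=
  `[- n%:R, n%:R] `&` f @^-1` `[- n%:R, n%:R].

Let measurable_truncation_set f n : measurable_fun setT f ->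
  measurable (truncation_set f n).
Proof.
move=> mf; apply: measurableI => //.
by rewrite -[X in measurable X]setTI; apply: mf.
Qed.

Let cvg_truncation f : L2 f ->
  \int[leb]_x ((f x - f x * \1_(truncation_set f n) x) ^+ 2) @[n --> \oo] --> (0 : R).
Proof.
move=> [mf Lf]; rewrite -[X in _ --> X](_ : \int[leb]_x (0 : R) = 0); last first.
  by rewrite Rintegral_cst// mul0r.
apply: (@dominated_convergence_R _ _ _ (fun x => f x ^+ 2)) => //.
- move=> n; apply: measurable_funX; apply: measurable_funB => //.
  apply: measurable_funM => //; apply: measurable_indic.
  exact: measurable_truncation_set.
- apply: aeW => x; apply: cvg_near_cst.
  near=> n; rewrite indicE mem_set ?mulr1 ?subrr ?expr0n//.
  split; rewrite /= in_itv/= -ler_norml.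
    by near: n; exact: nbhs_infty_ger.
  by near: n; exact: nbhs_infty_ger.
- move=> n x; rewrite normrX real_normK ?num_real// indicE.
  by case: (_ \in _); rewrite ?mulr1 ?subrr ?expr0n ?sqr_ge0// mulr0 subr0.
Unshelve. all: by end_near. Qed.

Let clamp (M y : R) := Num.max (- M) (Num.min y M).

Let clamp_bound M y : 0 <= M -> `|clamp M y| <= M.
Proof.
move=> M0; rewrite ler_norml /clamp le_max lexx/= ge_max ge_min lexx orbT andbT.
by rewrite lerNl; lra.
Qed.

(** [clamp M] is the nearest-point projection onto [-M, M]: it bounds an approximation without
    taking it farther from functions that obey the same bound. *)
Let clamp_dist M y a : 0 <= M -> `|a| <= M -> `|a - clamp M y| <= `|a - y|.
Proof.
move=> M0; rewrite /clamp ler_norml => /andP[a1 a2].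
case: (leP y M) => yM; case: (leP (- M)) => My //;
  rewrite ler_norml; have := ler_norm (a - y); have := lerNnormlW (lexx `|a - y|);
  by move=> h1 h2; apply/andP; split; lra.
Qed.

Let continuous_clamp M : continuous (clamp M).
Proof.
move=> y; apply: (@continuous_max _ _ (fun=> - M) (fun y => Num.min y M)).
  exact: cvg_cst.
by apply: (@continuous_min _ _ id (fun=> M)); [exact: cvg_id|exact: cvg_cst].
Qed.

Let E (M : R) : set R := `[- M, M]%classic.

(** Away from the two points M and - M the function agrees near x with [g] or with 0. *)
Let ae_continuous_restrict M g : continuous g -> ae_continuous (fun x => g x * \1_(E M) x).
Proof.
move=> cg; exists [set M; - M]; split.
- by apply: measurableU; exact: measurable_set1.
- have : countable [set M; - M] by apply: finite_set_countable; exact: finite_set2.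
  exact: countable_lebesgue_measure0.
move=> x /= ncx; apply: contrapT => /not_orP[xM xNM]; apply: ncx.
have [xlt|xge] := ltP `|x| M.
- have nE : \forall y \near x, g y = g y * \1_(E M) y.
    near=> y; rewrite indicE mem_set ?mulr1// /E /= in_itv/= -ler_norml.
    by near: y; apply: (cvgr_norm_le x).
  rewrite indicE mem_set ?mulr1; last by rewrite /E /= in_itv/= -ler_norml ltW.
  by apply: cvg_trans (cg x); apply: near_eq_cvg.
- have {}xge : M < `|x|.
    rewrite lt_neqAle xge andbT; apply/eqP => Mx.
    have [x0|x0] := leP 0 x; move: Mx; first by rewrite ger0_norm// => /esym.
    by rewrite ltr0_norm// => Mx; apply: xNM; rewrite Mx opprK.
  rewrite [X in _ --> X](_ : _ = 0); last first.
    rewrite indicE memNset ?mulr0// /E /= in_itv/= -ler_norml; apply/negP.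
    by rewrite -ltNge.
  apply: cvg_near_cst; near=> y.
  rewrite indicE memNset ?mulr0// /E /= in_itv/= -ler_norml; apply/negP.
  rewrite -ltNge; near: y; apply: (cvgr_norm_gt x) => //.
Unshelve. all: by end_near. Qed.

(** Cutting [f] to a set where both x and f x are bounded leaves a bounded function on [-M, M],
    where continuous functions are dense in L^1. Clamping the L^1 approximation turns closeness in
    L^1 into closeness in L^2, since the squared difference is then at most 2 M times the absolute
    one. *)
Lemma ae_continuous_dense f (d : R) : L2 f -> 0 < d ->
  exists g, [/\ L2 g, exists M, forall x, `|g x| <= M, ae_continuous g &
    \int[leb]_x ((f x - g x) ^+ 2) <= d].
Proof.
move=> Lf d0; have mf : measurable_fun setT f by case: Lf.
have d4 : 0 < d / 4 by lra.
have /cvgr0Pnorm_le/(_ _ d4)[n _ /(_ n (leqnn n)) In] := cvg_truncation Lf.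
pose A := truncation_set f n; have mA : measurable A by exact: measurable_truncation_set.
(* The successor makes the bound positive even when n = 0. *)
pose M : R := n.+1%:R; have M0 : 0 < M by rewrite ltr0n.
pose f0 x := f x * \1_A x.
have mf0 : measurable_fun setT f0.
  by apply: measurable_funM => //; exact: measurable_indic.
have nM : n%:R <= M :> R by rewrite ler_nat.
have f0M x : `|f0 x| <= M.
  rewrite /f0 indicE; case: (boolP (x \in A)) => [|_]; last by rewrite mulr0 normr0 ltW.
  by rewrite inE => -[_ /=]; rewrite in_itv/= -ler_norml mulr1 => /le_trans; apply.
have f0E x : ~ E M x -> f0 x = 0.
  move=> nEx; rewrite /f0 indicE memNset ?mulr0// => -[/=]; rewrite in_itv/= => /andP[h1 h2] _.
  by apply: nEx; rewrite /E /= in_itv/=; apply/andP; split; lra.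
have mE : measurable (E M) by exact: measurable_itv.
have muE : (leb (E M) < +oo)%E by rewrite lebesgue_measure_itv/=; case: ifP => _; rewrite ?ltry.
have L1E : L1 (\1_(E M)) by exact: integrable_indic_itv.
have L1f0 : leb.-integrable (E M) (EFin \o f0).
  apply: integrableS (_ : measurable setT) _ _ _ => //.
  apply: (@L1_le _ _ (fun x => M * \1_(E M) x)) => //; last exact: L1Z.
  move=> x; have [xE|xE] := pselect (E M x); first by rewrite indicE mem_set// mulr1.
  by rewrite f0E// normr0 mulr_ge0// ltW.
have [g_ [cg Lg]] := approximation_continuous_integrable mE muE L1f0.
(* The factor 2 M below turns this L^1 error into d / 4; with the d / 4 of the truncation, (a + b)^2
   <= 2 (a^2 + b^2) gives d in all. *)
have e0 : 0 < d / (8 * M) by rewrite divr_gt0// mulr_gt0.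
move=> /fine_cvgP[_ /cvgr0Pnorm_le/(_ _ e0)[k _ /(_ k (leqnn k))]] /=.
move: (cg k) (Lg k); move: (g_ k) => {cg Lg} {g_} g0 cg Lg Ik.
pose g x := clamp M (g0 x) * \1_(E M) x.
have cc : continuous (fun x => clamp M (g0 x)).
  by move=> x; apply: continuous_comp; [exact: cg|exact: continuous_clamp].
have mg : measurable_fun setT g.
  apply: measurable_funM; last exact: measurable_indic.
  exact: continuous_measurable_fun.
have gM x : `|g x| <= M.
  rewrite /g indicE; case: (x \in _); last by rewrite mulr0 normr0 ltW.
  by rewrite mulr1 clamp_bound// ltW.
have Lg2 : L2 g.
  split => //; apply: (@L1_le _ _ (fun x => M ^+ 2 * \1_(E M) x)); last exact: L1Z.
    exact: measurable_funX.
  move=> x; rewrite normrX; have [xE|xE] := pselect (E M x).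
    by rewrite indicE mem_set// mulr1 lerXn2r// nnegrE// ltW.
  by rewrite /g indicE memNset// !mulr0 normr0 expr0n.
exists g; split => //; first by exists M.
  exact: ae_continuous_restrict.
have Lf0 : L2 f0.
  rewrite /f0; under eq_fun do rewrite mulrC; apply: (@L2Mbounded _ _ (\1_A) 1) => //.
  by move=> x; rewrite indicE; case: (_ \in _); rewrite ?normr1 ?normr0.
have [_ Lff0] := L2B Lf Lf0; have [_ Lf0g] := L2B Lf0 Lg2.
have [_ Lfg] := L2B Lf Lg2.
have I2 : \int[leb]_x ((f0 x - g x) ^+ 2) <= d / 4.
  have LE : L1 (fun x => `|f0 x - g0 x| * \1_(E M) x).
    have : leb.-integrable (E M) (EFin \o (fun x => `|f0 x - g0 x|)).
      apply: integrable_norm. exact: (@integrableB _ _ _ leb (E M) mE _ _ L1f0 Lg).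
    move/(@integrable_mkcond _ _ _ leb (E M) _ mE).1; congr (leb.-integrable _ _).
    apply/funext => x; rewrite /= indicE /patch; case: (x \in E M) => /=.
      by rewrite mulr1.
    by rewrite mulr0.
  apply: (@le_trans _ _ (\int[leb]_x (2 * M * (`|f0 x - g0 x| * \1_(E M) x)))).
    apply: le_RintegralT => //; first exact: L1Z.
    move=> x; have [xE|xE] := pselect (E M x).
      rewrite /g indicE mem_set// !mulr1 -real_normK ?num_real// expr2.
      apply: ler_pM => //; last by apply: clamp_dist => //; exact: ltW.
      rewrite (le_trans (ler_normB _ _))//.
      by have := f0M x; have := @clamp_bound M (g0 x) (ltW M0); lra.
    by rewrite f0E// /g indicE memNset// !mulr0 subrr expr0n.
  rewrite RintegralZT//.
  have -> : \int[leb]_x (`|f0 x - g0 x| * \1_(E M) x) =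
      \int[leb]_(x in E M) `|f0 x - g0 x|.
    rewrite [RHS]Rintegral_mkcond; apply: eq_RintegralT => x.
    by rewrite /patch indicE; case: (x \in E M); rewrite ?mulr1 ?mulr0.
  rewrite (_ : d / 4 = 2 * M * (d / (8 * M))); last by field; rewrite gt_eqF.
  rewrite ler_pM2l ?mulr_gt0//; apply: le_trans Ik.
  exact: ler_norm.
apply: (@le_trans _ _ (\int[leb]_x (2 * ((f x - f0 x) ^+ 2 + (f0 x - g x) ^+ 2)))).
  apply: le_RintegralT => //; first by apply: L1Z; exact: L1D.
  move=> x; have := sqr_ge0 ((f x - f0 x) - (f0 x - g x)).
  rewrite !expr2; lra.
rewrite RintegralZT; last exact: L1D.
rewrite RintegralDT//.
have := ler_norm (\int[leb]_x ((f x - f0 x) ^+ 2)); move: In; rewrite /f0; lra.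
Qed.

Definition autocorrelation f u := \int[leb]_s (f s * f (s + u)).

(** Only the shifted factor is replaced by an almost everywhere continuous [g]. Then M |f|
    dominates, which is where [f] in L^1 serves, and the error is small uniformly in the shift
    because translations preserve the L^2 norm. *)
Lemma cvg_autocorrelation f (u : nat -> R) : L1 f -> L2 f -> u n @[n --> \oo] --> (0 : R) ->
  autocorrelation f (u n) @[n --> \oo] --> \int[leb]_s (f s ^+ 2).
Proof.
move=> L1f L2f u0; apply/cvgrPdist_le => d d0.
set N := \int[leb]_s (f s ^+ 2).
have N0 : 0 <= N by apply: Rintegral_ge0 => x _; exact: sqr_ge0.
(* This gives l N <= d / 4, the added 1 covering N = 0; [g] is taken with squared error at most l d
   / 4, so each remainder is at most d / 4. *)
pose l := d / (4 * (N + 1)).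
have l0 : 0 < l by rewrite divr_gt0// mulr_gt0// ltr_wpDl.
have ld : 0 < l * d / 4 by rewrite divr_gt0// mulr_gt0.
have [g [L2g [M gM] cg fg]] := ae_continuous_dense L2f ld.
pose k x := f x - g x; have L2k : L2 k by exact: L2B.
have lN : l * N <= d / 4.
  rewrite /l mulrAC ler_pdivrMr ?mulr_gt0 ?ltr_wpDl//.
  by rewrite (_ : d / 4 * _ = d * (N + 1)); [rewrite ler_pM2l//; lra|field].
have bk w : `|\int[leb]_s (f s * k (s + w))| <= d / 4.
  apply: (le_trans (Rintegral_mul_le L2f (L2_shift w L2k) l0)).
  have [_ Lk2] := L2k; rewrite (Rintegral_shift w Lk2) -/N.
  have : l^-1 * \int[leb]_s (k s ^+ 2) <= d / 4.
    by rewrite ler_pdivrMl// mulrA.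
  lra.
have split_ w : autocorrelation f w =
    \int[leb]_s (f s * g (s + w)) + \int[leb]_s (f s * k (s + w)).
  rewrite -RintegralDT; [|exact: L2M (L2_shift w L2g)|exact: L2M (L2_shift w L2k)].
  by apply: eq_RintegralT => s; rewrite /k; ring.
have NE : N = autocorrelation f 0.
  by apply: eq_RintegralT => s; rewrite addr0 expr2.
have /cvgrPdist_le : \int[leb]_s (f s * g (s + u n)) @[n --> \oo] -->
    \int[leb]_s (f s * g (s + 0)).
  have mg : measurable_fun setT g by case: L2g.
  have mf : measurable_fun setT f by case: L2f.
  apply: (@dominated_convergence_R _ _ _ (fun x => M * `|f x|)).
  - by move=> n; apply: measurable_funM => //; exact: measurable_shift.
  - by apply: measurable_funM => //; exact: measurable_shift.
  - apply: ae_leb_sub cg => x cgx; apply: cvgM; first exact: cvg_cst.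
    rewrite addr0; apply: (cvg_comp (fun n => x + u n) g _ cgx).
    have : x + u n @[n --> \oo] --> x + 0 by apply: cvgD => //; exact: cvg_cst.
    by rewrite addr0.
  - exact/L1Z/L1_norm.
  - by move=> n x; rewrite normrM mulrC ler_wpM2r.
have d2 : 0 < d / 2 by lra.
move=> /(_ _ d2); apply: filterS => n.
rewrite NE !split_.
have := bk 0; have := bk (u n); rewrite !ler_norml.
by move=> /andP[h1 h2] /andP[h3 h4] /andP[h5 h6]; apply/andP; split; lra.
Qed.

End Density.

(** * Cosine and sine transforms, and Plancherel's identity *)

Section Transform.
Variable R : realType.
Local Notation leb := (@lebesgue_measure R).
Implicit Types f g h : R -> R.

Section Trig.
Variable c : R -> R.
Hypotheses (mc : measurable_fun setT c) (c1 : forall x, `|c x| <= 1).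

(** The kernel [c] is any measurable function bounded by 1, so that cosine and sine are treated
    together. *)
Definition trig_transform f (nu : R) := \int[leb]_t (f t * c (2 * pi * nu * t)).

Let measurable_phase : measurable_fun setT (fun z : R * R => c (2 * pi * z.1 * z.2)).
Proof.
apply: (measurableT_comp mc); apply: measurable_funM => //.
by apply: measurable_funM => //.
Qed.

Let measurable_phase2 (nu : R) : measurable_fun setT (fun t : R => c (2 * pi * nu * t)).
Proof. by apply: (measurableT_comp mc); exact: measurable_funM. Qed.

Lemma L1_trig nu f : L1 f -> L1 (fun t => f t * c (2 * pi * nu * t)).
Proof. by move=> Lf; apply: (L1Mbounded Lf (measurable_phase2 nu)). Qed.

Lemma trig_transform_bound f nu : L1 f -> `|trig_transform f nu| <= \int[leb]_t `|f t|.
Proof.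
move=> Lf; apply: (le_trans (le_normr_Rintegral measurableT (L1_trig nu Lf))).
apply: le_RintegralT; [exact: L1_norm (L1_trig nu Lf)|exact: L1_norm|].
by move=> x; rewrite normrM ler_piMr.
Qed.

Lemma trig_transformD f g nu : L1 f -> L1 g ->
  trig_transform (fun t => f t + g t) nu = trig_transform f nu + trig_transform g nu.
Proof.
move=> Lf Lg; rewrite -(RintegralDT (L1_trig nu Lf) (L1_trig nu Lg)).
by apply: eq_RintegralT => t; rewrite mulrDl.
Qed.

Let F f g (z : R * R) := g z.1 * f z.2 * c (2 * pi * z.1 * z.2).

Let measurable_F f g : L1 f -> L1 g -> measurable_fun setT (F f g).
Proof.
move=> /L1_measurable mf /L1_measurable mg; apply: measurable_funM => //.
by apply: measurable_funM; [exact: (measurableT_comp mg)|exact: (measurableT_comp mf)].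
Qed.

Let F_bound f g x y : `|F f g (x, y)| <= `|g x| * `|f y|.
Proof. by rewrite /F /= normrM normrM ler_piMr. Qed.

Let integrable_F f g : L1 f -> L1 g -> (leb \x leb)%E.-integrable setT (EFin \o F f g).
Proof.
move=> Lf Lg; apply: (integrable_prod_dominated (measurable_F Lf Lg) (L1_norm Lg) (L1_norm Lf)).
exact: F_bound.
Qed.

Let F1 f g x : L1 f -> L1 (fun y => F f g (x, y)).
Proof.
move=> Lf; have := L1Z (g x) (L1_trig x Lf); congr L1.
by apply/funext => y; rewrite /F /= mulrA.
Qed.

Let F2 f g y : L1 g -> L1 (fun x => F f g (x, y)).
Proof.
move=> Lg; have := L1Z (f y) (L1_trig y Lg); congr L1.
by apply/funext => x; rewrite /F /= mulrA [f y * _]mulrC [_ * x * y]mulrAC.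
Qed.

(** Fubini's theorem yields measurability in x for a function integrable on the plane, which f(y)
    c(2 pi x y) need not be; it is multiplied by the integrable [abel_kernel 1], and this factor is
    divided out again. *)
Lemma measurable_trig_transform f : L1 f -> measurable_fun setT (trig_transform f).
Proof.
move=> Lf; have Lk := L1_abel_kernel (ltr01 : 0 < 1 :> R).
have /L1_measurable m1 := L1_Rintegral_section (integrable_F Lf Lk)
  (fun x => F1 (abel_kernel 1) x Lf).
have -> : trig_transform f = (fun x => expR `|x| * \int[leb]_y (F f (abel_kernel 1) (x, y))).
  apply/funext => x; under eq_RintegralT do rewrite /F /= -mulrA.
  rewrite (RintegralZT _ (L1_trig x Lf)).
  by rewrite mulrA /abel_kernel mul1r -expRD subrr expR0 mul1r.
apply: measurable_funM => //; apply: measurableT_comp => //.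
Qed.

(* The kernel is symmetric. *)
Lemma trig_transform_adjoint f g : L1 f -> L1 g ->
  \int[leb]_t (trig_transform f t * g t) = \int[leb]_t (f t * trig_transform g t).
Proof.
move=> Lf Lg.
have := Rintegral_Fubini (integrable_F Lf Lg) (fun x => F1 g x Lf) (fun y => F2 f y Lg).
congr (_ = _); apply: eq_RintegralT => x.
  under eq_RintegralT do rewrite /F /= -mulrA.
  rewrite (RintegralZT (g x) (L1_trig x Lf)) mulrC; reflexivity.
rewrite -(RintegralZT (f x) (L1_trig x Lg)).
by apply: eq_RintegralT => y; rewrite /F /= mulrA [f x * _]mulrC [_ * x * y]mulrAC.
Qed.

End Trig.

Definition cos_transform := trig_transform (@cos R).
Definition sin_transform := trig_transform (@sin R).

Let mcos : measurable_fun setT (@cos R).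
Proof. by apply: continuous_measurable_fun; exact: continuous_cos. Qed.
Let msin : measurable_fun setT (@sin R).
Proof. by apply: continuous_measurable_fun; exact: continuous_sin. Qed.
Let cos1 (x : R) : `|cos x| <= 1. Proof. exact: cos_max. Qed.
Let sin1 (x : R) : `|sin x| <= 1. Proof. exact: sin_max. Qed.

Section Autocorrelation.
Variable f : R -> R.
Hypotheses (L1f : L1 f) (L2f : L2 f).

Let G (z : R * R) := f z.2 * f (z.2 + z.1).

Let mG : measurable_fun setT G.
Proof.
have mf := L1_measurable L1f.
apply: measurable_funM; first exact: (measurableT_comp mf).
by apply: (measurableT_comp mf); exact: measurable_funD.
Qed.

(** With s outermost, the inner integral of |f(s + u)| over u is the L^1 norm of [f] for every s, so
    the double integral is the square of that norm. *)
Let iG : (leb \x leb)%E.-integrable setT (EFin \o G).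
Proof.
apply/integrable21ltyP; first exact/measurable_EFinP.
have -> : (\int[leb]_y \int[leb]_x `|(EFin \o G) (x, y)| =
    \int[leb]_y (`|f y| * \int[leb]_x `|f x|)%:E)%E.
  apply: eq_integral => y _.
  have LN := L1_norm L1f.
  rewrite -(Rintegral_shift y LN) -RintegralZT; last exact: (L1_shift y LN).
  rewrite EFin_Rintegral; last exact: (L1Z _ (L1_shift y LN)).
  by apply: eq_integral => x _; rewrite /G /= normrM [y + x]addrC.
rewrite -EFin_Rintegral ?ltry//.
by under eq_fun do rewrite mulrC; exact/L1Z/L1_norm.
Qed.

Let G1 u : L1 (fun s => G (u, s)).
Proof. exact: L2M (L2_shift u L2f). Qed.

Lemma L1_autocorrelation : L1 (autocorrelation f).
Proof. exact: (L1_Rintegral_section iG G1). Qed.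

Lemma autocorrelation_bound u : `|autocorrelation f u| <= \int[leb]_s (f s ^+ 2).
Proof.
apply: (le_trans (Rintegral_mul_le L2f (L2_shift u L2f) ltr01)).
have [_ L2f2] := L2f; rewrite (Rintegral_shift u L2f2) invr1 mul1r.
by lra.
Qed.

(** The Wiener-Khinchin identity: with t = u + s, the subtraction formula for cos (2 pi nu (t - s))
    splits the double integral into two squares. *)
Lemma cos_transform_autocorrelation nu :
  cos_transform (autocorrelation f) nu = cos_transform f nu ^+ 2 + sin_transform f nu ^+ 2.
Proof.
pose H (z : R * R) := G z * cos (2 * pi * nu * z.1).
have mH : measurable_fun setT H.
  apply: measurable_funM => //; apply: (measurableT_comp mcos).
  exact: measurable_funM.
have iH : (leb \x leb)%E.-integrable setT (EFin \o H).
  apply: le_integrable iG => //; first exact/measurable_EFinP.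
  by move=> z _; rewrite lee_fin /H normrM ler_piMr.
have H1 u : L1 (fun s => H (u, s)).
  have := L1Z (cos (2 * pi * nu * u)) (G1 u); congr L1.
  by apply/funext => s; rewrite mulrC.
have H2 s : L1 (fun u => H (u, s)).
  have := L1Z (f s) (L1_trig mcos cos1 nu (L1_shift s L1f)); congr L1.
  by apply/funext => u; rewrite /H /G /= mulrA [s + u]addrC.
have L1ft := L1_trig mcos cos1 nu L1f; have L1fs := L1_trig msin sin1 nu L1f.
transitivity (\int[leb]_u \int[leb]_s H (u, s)).
  apply: eq_RintegralT => u; rewrite mulrC -RintegralZT; last exact: G1.
  by apply: eq_RintegralT => s; rewrite /H mulrC.
rewrite (Rintegral_Fubini iH H1 H2).
transitivity (\int[leb]_s (cos_transform f nu * (f s * cos (2 * pi * nu * s)) +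
    sin_transform f nu * (f s * sin (2 * pi * nu * s)))); last first.
  by rewrite RintegralDT ?RintegralZT ?expr2//; exact: L1Z.
apply: eq_RintegralT => s.
pose K t := cos (2 * pi * nu * s) * (f t * cos (2 * pi * nu * t)) +
  sin (2 * pi * nu * s) * (f t * sin (2 * pi * nu * t)).
have LK : L1 K by apply: L1D; exact: L1Z.
transitivity (\int[leb]_u (f s * K (u + s))).
  apply: eq_RintegralT => u; rewrite /H /G /K /= [s + u]addrC -mulrA; congr (_ * _).
  rewrite (_ : 2 * pi * nu * u = 2 * pi * nu * (u + s) - 2 * pi * nu * s); last by ring.
  by rewrite cosB; ring.
rewrite RintegralZT; last exact: (L1_shift s LK).
rewrite (Rintegral_shift s LK) RintegralDT; [|exact: L1Z|exact: L1Z].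
rewrite !RintegralZT// -/(cos_transform f nu) -/(sin_transform f nu).
by rewrite /cos_transform /sin_transform /trig_transform; ring.
Qed.

(** These parameters decrease to 0, so the Abel weights increase to 1. *)
Let e_ (n : nat) : R := n.+1%:R^-1.
Let e_gt0 n : 0 < e_ n. Proof. by rewrite invr_gt0. Qed.

Let power nu := cos_transform f nu ^+ 2 + sin_transform f nu ^+ 2.

Let power_ge0 nu : 0 <= power nu. Proof. by rewrite addr_ge0 ?sqr_ge0. Qed.

(** Adjointness moves the cosine transform from the autocorrelation to the Abel kernel, where it is
    explicit; the substitution u = e v then leaves the parameter only inside the autocorrelation. *)
Let abel_mean n : \int[leb]_nu (abel_kernel (e_ n) nu * power nu) =
  \int[leb]_v (poisson_kernel v * autocorrelation f (e_ n * v)).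
Proof.
have LA := L1_autocorrelation; have Lk := L1_abel_kernel (e_gt0 n).
transitivity (\int[leb]_u (autocorrelation f u * cos_transform (abel_kernel (e_ n)) u)).
  rewrite -(trig_transform_adjoint mcos cos1 LA Lk).
  apply: eq_RintegralT => nu; rewrite mulrC; congr (_ * _).
  by rewrite -/cos_transform cos_transform_autocorrelation.
have cE u : cos_transform (abel_kernel (e_ n)) u =
  2 * e_ n / (e_ n ^+ 2 + (2 * pi * u) ^+ 2) by exact: Rintegral_abel_kernel_cos.
have LP : L1 (fun u => autocorrelation f u * cos_transform (abel_kernel (e_ n)) u).
  apply: (L1Mbounded LA (measurable_trig_transform mcos cos1 Lk)) => u.
  exact: (trig_transform_bound mcos cos1 u Lk).
rewrite (Rintegral_affine 0 (e_gt0 n) LP) -(RintegralZT _ (L1_affine 0 (e_gt0 n) LP)).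
apply: eq_RintegralT => v; rewrite cE add0r /poisson_kernel.
have e0 := e_gt0 n; have h : 0 < 1 + (2 * pi * v) ^+ 2 by rewrite ltr_pwDl// sqr_ge0.
have h2 : 0 < e_ n ^+ 2 + (2 * pi * (e_ n * v)) ^+ 2.
  by rewrite ltr_pwDl ?sqr_ge0// exprn_gt0.
move: (2 * pi) (e_ n) e0 h h2 => p e e0 h h2.
by field; rewrite !gt_eqF.
Qed.

(** The autocorrelation is at most [N] in modulus, so [N] times the Poisson kernel dominates; that
    kernel has mass 1. *)
Let cvg_abel_mean : \int[leb]_nu (abel_kernel (e_ n) nu * power nu) @[n --> \oo] -->
  \int[leb]_s (f s ^+ 2).
Proof.
set N := \int[leb]_s (f s ^+ 2).
have [Lp p1] := L1_poisson_kernel_integral R.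
have -> : N = \int[leb]_v (poisson_kernel v * N) by rewrite RintegralZr// p1 mul1r.
rewrite (_ : (fun n => _) = (fun n =>
    \int[leb]_v (poisson_kernel v * autocorrelation f (e_ n * v)))); last first.
  by apply/funext => n; exact: abel_mean.
have mA := L1_measurable L1_autocorrelation.
apply: (@dominated_convergence_R _ _ _ (fun v => N * poisson_kernel v)).
- move=> n; apply: measurable_funM; first exact: L1_measurable.
  by apply: (measurableT_comp mA); exact: measurable_funM.
- by apply: measurable_funM => //; exact: L1_measurable.
- apply: aeW => v; apply: cvgM; first exact: cvg_cst.
  apply: (cvg_autocorrelation L1f L2f).
  have : e_ n * v @[n --> \oo] --> 0 * v.
    by apply: cvgM; [exact: cvg_harmonic|exact: cvg_cst].
  by rewrite mul0r.
- exact: L1Z.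
- move=> n v; rewrite normrM mulrC [`|poisson_kernel v|]ger0_norm ?poisson_kernel_ge0//.
  by rewrite ler_wpM2r ?poisson_kernel_ge0// autocorrelation_bound.
Qed.

(** Stated in the extended reals because integrability of the power spectrum is a consequence:
    monotone convergence applies to the Abel means, whose limit is known and finite. *)
Lemma Plancherel_integral : (\int[leb]_nu (power nu)%:E = (\int[leb]_s (f s ^+ 2))%:E)%E.
Proof.
have mcf := measurable_trig_transform mcos cos1 L1f.
have msf := measurable_trig_transform msin sin1 L1f.
have mp : measurable_fun setT power.
  by apply: measurable_funD; exact: measurable_funX.
have mk e : measurable_fun setT (@abel_kernel R e).
  by apply: continuous_measurable_fun; exact: continuous_abel_kernel.
have Lkp n : L1 (fun nu => abel_kernel (e_ n) nu * power nu).
  apply: (@L1Mbounded _ _ _ ((\int[leb]_t `|f t|) ^+ 2 + (\int[leb]_t `|f t|) ^+ 2)) => //.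
    exact: L1_abel_kernel.
  move=> x; rewrite ger0_norm// lerD// -real_normK ?num_real// lerXn2r ?nnegrE//.
  - by apply: Rintegral_ge0.
  - exact: (trig_transform_bound mcos cos1 x L1f).
  - by apply: Rintegral_ge0.
  - exact: (trig_transform_bound msin sin1 x L1f).
have cvgk x : (abel_kernel (e_ n) x * power x)%:E @[n --> \oo] --> (power x)%:E.
  apply: cvg_EFin; first exact: nearW.
  have : abel_kernel (e_ n) x * power x @[n --> \oo] --> 1 * power x.
    apply: cvgM; last exact: cvg_cst.
    rewrite -expR0 -[in X in _ --> X]oppr0 -(mul0r `|x|).
    apply: continuous_cvg; first exact: continuous_expR.
    by apply: cvgN; apply: cvgM; [exact: cvg_harmonic|exact: cvg_cst].
  by rewrite mul1r.
have ndk x : nondecreasing_seq (fun n => (abel_kernel (e_ n) x * power x)%:E).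
  move=> m n mn; rewrite lee_fin ler_wpM2r// ler_expR lerN2 ler_wpM2r//.
  by rewrite lef_pV2 ?posrE// ler_nat.
have := @cvg_monotone_convergence _ _ R leb setT measurableT
  (fun n nu => (abel_kernel (e_ n) nu * power nu)%:E)
  (fun n => measurable_int _ (Lkp n)) (fun n x _ => mulr_ge0 (expR_ge0 _) (power_ge0 x))
  (fun x _ => ndk x).
under [X in _ --> X -> _]eq_integral do rewrite (cvg_lim _ (cvgk _))//.
have -> : (fun n => \int[leb]_x (abel_kernel (e_ n) x * power x)%:E)%E =
    EFin \o (fun n => \int[leb]_x (abel_kernel (e_ n) x * power x)).
  by apply/funext => n /=; rewrite EFin_Rintegral.
have c2 : (EFin \o (fun n => \int[leb]_x (abel_kernel (e_ n) x * power x))) @ \oo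
    --> (\int[leb]_s (f s ^+ 2))%:E.
  by apply: cvg_EFin; [exact: nearW|exact: cvg_abel_mean].
by move=> c1; exact: (cvg_unique _ c1 c2).
Qed.

End Autocorrelation.

End Transform.

(** * Parseval's identity and adjointness for pairs of real functions, and their passage to L^2 *)

Section Parseval.
Variable R : realType.
Local Notation leb := (@lebesgue_measure R).
Implicit Types f g h : R -> R.
Local Notation C := (@cos_transform R).
Local Notation S := (@sin_transform R).

Lemma measurable_cos_transform f : L1 f -> measurable_fun setT (C f).
Proof.
apply: measurable_trig_transform; last exact: cos_max.
by apply: continuous_measurable_fun; exact: continuous_cos.
Qed.

Lemma measurable_sin_transform f : L1 f -> measurable_fun setT (S f).
Proof.
apply: measurable_trig_transform; last exact: sin_max.
by apply: continuous_measurable_fun; exact: continuous_sin.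
Qed.

Lemma cos_transformD f g nu : L1 f -> L1 g ->
  C (fun t => f t + g t) nu = C f nu + C g nu.
Proof.
apply: trig_transformD; last exact: cos_max.
by apply: continuous_measurable_fun; exact: continuous_cos.
Qed.

Lemma sin_transformD f g nu : L1 f -> L1 g ->
  S (fun t => f t + g t) nu = S f nu + S g nu.
Proof.
apply: trig_transformD; last exact: sin_max.
by apply: continuous_measurable_fun; exact: continuous_sin.
Qed.

Lemma cos_transform_adjoint f g : L1 f -> L1 g ->
  \int[leb]_t (C f t * g t) = \int[leb]_t (f t * C g t).
Proof.
apply: trig_transform_adjoint; last exact: cos_max.
by apply: continuous_measurable_fun; exact: continuous_cos.
Qed.

Lemma sin_transform_adjoint f g : L1 f -> L1 g ->
  \int[leb]_t (S f t * g t) = \int[leb]_t (f t * S g t).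
Proof.
apply: trig_transform_adjoint; last exact: sin_max.
by apply: continuous_measurable_fun; exact: continuous_sin.
Qed.

Definition L12 f := L1 f /\ L2 f.

Lemma L12D f g : L12 f -> L12 g -> L12 (fun x => f x + g x).
Proof. by move=> [f1 f2] [g1 g2]; split; [exact: L1D|exact: L2D]. Qed.

Lemma L1_power_spectrum f : L12 f -> L1 (fun nu => C f nu ^+ 2 + S f nu ^+ 2).
Proof.
move=> [f1 f2]; apply: L1_fin_integral.
- apply: measurable_funD; apply: measurable_funX.
    exact: measurable_cos_transform.
  exact: measurable_sin_transform.
- by move=> x; rewrite addr_ge0 ?sqr_ge0.
- by rewrite Plancherel_integral// ltry.
Qed.

Lemma L2_cos_transform f : L12 f -> L2 (C f).
Proof.
move=> Lf; have mC := measurable_cos_transform Lf.1; split => //.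
apply: (L1_le _ _ (L1_power_spectrum Lf)); first exact: measurable_funX.
by move=> x; rewrite ger0_norm ?sqr_ge0// lerDl sqr_ge0.
Qed.

Lemma L2_sin_transform f : L12 f -> L2 (S f).
Proof.
move=> Lf; have mS := measurable_sin_transform Lf.1; split => //.
apply: (L1_le _ _ (L1_power_spectrum Lf)); first exact: measurable_funX.
by move=> x; rewrite ger0_norm ?sqr_ge0// lerDr sqr_ge0.
Qed.

Lemma Plancherel f : L12 f ->
  \int[leb]_nu (C f nu ^+ 2) + \int[leb]_nu (S f nu ^+ 2) = \int[leb]_t (f t ^+ 2).
Proof.
move=> Lf; have [_ LC] := L2_cos_transform Lf; have [_ LS] := L2_sin_transform Lf.
rewrite -RintegralDT//; have [f1 f2] := Lf.
by rewrite /Rintegral Plancherel_integral.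
Qed.

Lemma Rintegral_sqrD f g : L2 f -> L2 g ->
  \int[leb]_x ((f x + g x) ^+ 2) =
  \int[leb]_x (f x ^+ 2) + 2 * \int[leb]_x (f x * g x) + \int[leb]_x (g x ^+ 2).
Proof.
move=> Lf Lg; have [_ Lf2] := Lf; have [_ Lg2] := Lg; have Lfg := L2M Lf Lg.
rewrite -(RintegralZT 2 Lfg) -(RintegralDT Lf2 (L1Z 2 Lfg)).
rewrite -(RintegralDT (L1D Lf2 (L1Z 2 Lfg)) Lg2).
by apply: eq_RintegralT => x; ring.
Qed.

(** Polarization of Plancherel's identity for f, g and f + g. *)
Lemma Parseval f g : L12 f -> L12 g ->
  \int[leb]_nu (C f nu * C g nu) + \int[leb]_nu (S f nu * S g nu) =
  \int[leb]_t (f t * g t).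
Proof.
move=> Lf Lg.
have := Plancherel (L12D Lf Lg); have := Plancherel Lf; have := Plancherel Lg.
have -> : C (fun t => f t + g t) = (fun nu => C f nu + C g nu).
  by apply/funext => nu; rewrite (cos_transformD _ Lf.1 Lg.1).
have -> : S (fun t => f t + g t) = (fun nu => S f nu + S g nu).
  by apply/funext => nu; rewrite (sin_transformD _ Lf.1 Lg.1).
rewrite (Rintegral_sqrD (L2_cos_transform Lf) (L2_cos_transform Lg)).
rewrite (Rintegral_sqrD (L2_sin_transform Lf) (L2_sin_transform Lg)).
rewrite (Rintegral_sqrD Lf.2 Lg.2).
have lin (a b c d p q r n m : R) : c + d = m -> a + b = n ->
  a + 2 * p + c + (b + 2 * q + d) = n + 2 * r + m -> p + q = r by lra.
exact: lin.
Qed.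

(** Reflection exchanges the positive and the negative part, so they have the same integral. *)
Lemma Rintegral_odd h : L1 h -> (forall x, h (- x) = - h x) -> \int[leb]_x h x = 0.
Proof.
move=> Lh oh; pose p x := (`|h x| + h x) / 2; pose n x := (`|h x| - h x) / 2.
have Lp : L1 p.
  by rewrite /p; under eq_fun do rewrite mulrC; apply: L1Z; apply: L1D => //; exact: L1_norm.
have Ln : L1 n.
  by rewrite /n; under eq_fun do rewrite mulrC; apply: L1Z; apply: L1B => //; exact: L1_norm.
have hE : h =1 (fun x => p x - n x) by move=> x; rewrite /p /n; field.
rewrite (eq_RintegralT hE) (RintegralBT Lp Ln) /Rintegral (@ge0_integral_opp _ p).
- rewrite -[X in _ - X]/(fine (\int[leb]_x (n x)%:E)).
  apply/eqP; rewrite subr_eq0; apply/eqP; congr fine; apply: eq_integral => x _.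
  by rewrite /p /n oh normrN.
- exact: L1_measurable.
- by move=> x; rewrite /p; have := lerNnormlW (lexx `|h x|); lra.
Qed.

Lemma cos_transformN f nu : C f (- nu) = C f nu.
Proof. by apply: eq_RintegralT => t; rewrite mulrN mulNr cosN. Qed.

Lemma sin_transformN f nu : L1 f -> S f (- nu) = - S f nu.
Proof.
move=> Lf; rewrite -RintegralNT; first by apply: eq_RintegralT => t; rewrite mulrN mulNr sinN mulrN.
apply: L1_trig => //; last exact: sin_max.
by apply: continuous_measurable_fun; exact: continuous_sin.
Qed.

(** A cosine transform is even and a sine transform odd. This removes the cross terms in
    [pair_Parseval]. *)
Lemma Rintegral_cos_sin_transform f g : L12 f -> L12 g ->
  \int[leb]_nu (C f nu * S g nu) = 0.
Proof.
move=> Lf Lg; apply: Rintegral_odd; first exact: L2M (L2_cos_transform Lf) (L2_sin_transform Lg).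
by move=> x; rewrite cos_transformN (sin_transformN _ Lg.1) mulrN.
Qed.

(* The two coordinates of (x + mu y) e^{- s mu 2 pi nu t} integrated over t:
   s = 1 is the direct transform, s = -1 the inverse one. *)
Definition pair_transform1 (s : R) x y nu := C x nu + s * S y nu.
Definition pair_transform2 (s : R) x y nu := C y nu - s * S x nu.

Lemma L2_pair_transform1 s x y : L12 x -> L12 y -> L2 (pair_transform1 s x y).
Proof.
move=> Lx Ly; apply: L2D; first exact: L2_cos_transform.
exact: L2Z (L2_sin_transform Ly).
Qed.

Lemma L2_pair_transform2 s x y : L12 x -> L12 y -> L2 (pair_transform2 s x y).
Proof.
move=> Lx Ly; apply: L2B; first exact: L2_cos_transform.
exact: L2Z (L2_sin_transform Lx).
Qed.

(** The transform acts as the matrix [[C, s S], [- s S, C]]. The products of a C with an S integrate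
    to 0, and the others regroup into [Parseval] for x, a and for y, b. *)
Lemma pair_Parseval s x y a b : s ^+ 2 = 1 -> L12 x -> L12 y -> L12 a -> L12 b ->
  \int[leb]_nu (pair_transform1 s x y nu * pair_transform1 s a b nu) +
  \int[leb]_nu (pair_transform2 s x y nu * pair_transform2 s a b nu) =
  \int[leb]_t (x t * a t) + \int[leb]_t (y t * b t).
Proof.
move=> s2 Lx Ly La Lb.
have Cx := L2_cos_transform Lx; have Cy := L2_cos_transform Ly.
have Ca := L2_cos_transform La; have Cb := L2_cos_transform Lb.
have Sx := L2_sin_transform Lx; have Sy := L2_sin_transform Ly.
have Sa := L2_sin_transform La; have Sb := L2_sin_transform Lb.
have expand (p q p' q' : R -> R) (r : R) : L2 p -> L2 q -> L2 p' -> L2 q' ->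
    \int[leb]_nu ((p nu + r * q nu) * (p' nu + r * q' nu)) =
    \int[leb]_nu (p nu * p' nu) + r * \int[leb]_nu (p nu * q' nu) +
    r * \int[leb]_nu (p' nu * q nu) + r ^+ 2 * \int[leb]_nu (q nu * q' nu).
  move=> Lp Lq Lp' Lq'.
  have L11 := L2M Lp Lp'; have L12' := L2M Lp Lq'; have L21 := L2M Lp' Lq.
  have L22 := L2M Lq Lq'.
  rewrite -(RintegralZT r L12') -(RintegralZT r L21) -(RintegralZT (r ^+ 2) L22).
  rewrite -(RintegralDT L11 (L1Z r L12')) -(RintegralDT (L1D L11 (L1Z r L12')) (L1Z r L21)).
  rewrite -(RintegralDT (L1D (L1D L11 (L1Z r L12')) (L1Z r L21)) (L1Z (r ^+ 2) L22)).
  by apply: eq_RintegralT => nu; ring.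
have E2 : \int[leb]_nu (pair_transform2 s x y nu * pair_transform2 s a b nu) =
    \int[leb]_nu ((C y nu + (- s) * S x nu) * (C b nu + (- s) * S a nu)).
  by apply: eq_RintegralT => nu; rewrite /pair_transform2; ring.
rewrite E2 (expand _ _ _ _ s Cx Sy Ca Sb) (expand _ _ _ _ (- s) Cy Sx Cb Sa).
rewrite (Rintegral_cos_sin_transform Lx Lb) (Rintegral_cos_sin_transform La Ly).
rewrite (Rintegral_cos_sin_transform Ly La) (Rintegral_cos_sin_transform Lb Lx).
rewrite sqrrN s2 -(Parseval Lx La) -(Parseval Ly Lb) !mulr0 !addr0 !mul1r.
have lin (p q r t : R) : p + q + (r + t) = p + t + (r + q) by ring.
exact: lin.
Qed.

(** C and S are symmetric, so transposing the matrix [[C, s S], [- s S, C]] changes the sign of s: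
    the direct and the inverse transform are adjoint to each other. *)
Lemma pair_adjoint s x y a b : L12 x -> L12 y -> L12 a -> L12 b ->
  \int[leb]_t (pair_transform1 s x y t * a t) + \int[leb]_t (pair_transform2 s x y t * b t) =
  \int[leb]_t (x t * pair_transform1 (- s) a b t) + \int[leb]_t (y t * pair_transform2 (- s) a b t).
Proof.
move=> Lx Ly La Lb.
have Cx := L2M (L2_cos_transform Lx) La.2; have Sy := L2M (L2_sin_transform Ly) La.2.
have Cy := L2M (L2_cos_transform Ly) Lb.2; have Sx := L2M (L2_sin_transform Lx) Lb.2.
have Ca := L2M Lx.2 (L2_cos_transform La); have Sb := L2M Lx.2 (L2_sin_transform Lb).
have Cb := L2M Ly.2 (L2_cos_transform Lb); have Sa := L2M Ly.2 (L2_sin_transform La).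
transitivity ((\int[leb]_t (C x t * a t) + s * \int[leb]_t (S y t * a t)) +
   (\int[leb]_t (C y t * b t) + - s * \int[leb]_t (S x t * b t))).
  rewrite -!RintegralZT// -(RintegralDT Cx (L1Z s Sy)) -(RintegralDT Cy (L1Z (- s) Sx)).
  by congr (_ + _); apply: eq_RintegralT => t; rewrite /pair_transform1 /pair_transform2; ring.
transitivity ((\int[leb]_t (x t * C a t) + - s * \int[leb]_t (x t * S b t)) +
   (\int[leb]_t (y t * C b t) + s * \int[leb]_t (y t * S a t))); last first.
  rewrite -!RintegralZT// -(RintegralDT Ca (L1Z (- s) Sb)) -(RintegralDT Cb (L1Z s Sa)).
  by congr (_ + _); apply: eq_RintegralT => t; rewrite /pair_transform1 /pair_transform2; ring.
rewrite (cos_transform_adjoint Lx.1 La.1) (sin_transform_adjoint Ly.1 La.1).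
rewrite (cos_transform_adjoint Ly.1 Lb.1) (sin_transform_adjoint Lx.1 Lb.1).
have lin (p q r t : R) : p + q + (r + t) = p + t + (r + q) by ring.
exact: lin.
Qed.

Definition L2_tends (u : nat -> R -> R) f :=
  (\int[leb]_t ((u n t - f t) ^+ 2)%:E)%E @[n --> \oo] --> 0%E.

Lemma L2_tends_Rintegral u f : L2_tends u f ->
  \int[leb]_t ((u n t - f t) ^+ 2) @[n --> \oo] --> (0 : R).
Proof. by move=> H; apply: fine_cvg. Qed.

Lemma cvg_Rintegral_mul_null (h : nat -> R -> R) g : (forall n, L2 (h n)) -> L2 g ->
  \int[leb]_t (h n t ^+ 2) @[n --> \oo] --> (0 : R) ->
  \int[leb]_t (g t * h n t) @[n --> \oo] --> (0 : R).
Proof.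
move=> Lh Lg h0; apply/cvgr0Pnorm_le => d d0.
set N := \int[leb]_t (g t ^+ 2).
have N0 : 0 <= N by apply: Rintegral_ge0 => x _; exact: sqr_ge0.
(* Then l N <= d, and eventually the integral of h_n^2 is at most l d, so the half sum in
   [Rintegral_mul_le] is at most d. *)
pose l := d / (N + 1).
have l0 : 0 < l by rewrite divr_gt0// ltr_wpDl.
have lN : l * N <= d.
  by rewrite /l mulrAC ler_pdivrMr ?ltr_wpDl// ler_pM2l//; lra.
have ld : 0 < l * d by rewrite mulr_gt0.
move/cvgr0Pnorm_le : h0 => /(_ _ ld); apply: filterS => n hn.
apply: (le_trans (Rintegral_mul_le Lg (Lh n) l0)); rewrite -/N.
have : l^-1 * \int[leb]_t (h n t ^+ 2) <= d.
  by rewrite ler_pdivrMl//; apply: le_trans hn; exact: ler_norm.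
lra.
Qed.

(** Joint continuity of the inner product, from u v = f g + g (u - f) + f (v - g) + (u - f) (v -
    g). *)
Lemma cvg_Rintegral_mul (u v : nat -> R -> R) f g :
  (forall n, L2 (u n)) -> (forall n, L2 (v n)) -> L2 f -> L2 g ->
  L2_tends u f -> L2_tends v g ->
  \int[leb]_t (u n t * v n t) @[n --> \oo] --> \int[leb]_t (f t * g t).
Proof.
move=> Lu Lv Lf Lg /L2_tends_Rintegral uf /L2_tends_Rintegral vg.
have Luf n : L2 (fun t => u n t - f t) by exact: L2B.
have Lvg n : L2 (fun t => v n t - g t) by exact: L2B.
have c1 := cvg_Rintegral_mul_null Luf Lg uf.
have c2 := cvg_Rintegral_mul_null Lvg Lf vg.
have c3 : \int[leb]_t ((u n t - f t) * (v n t - g t)) @[n --> \oo] --> (0 : R).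
  apply/cvgr0Pnorm_le => d d0; near=> n.
  apply: (le_trans (Rintegral_mul_le (Luf n) (Lvg n) ltr01)).
  have : `|\int[leb]_t ((u n t - f t) ^+ 2)| <= d by near: n; move/cvgr0Pnorm_le : uf; exact.
  have : `|\int[leb]_t ((v n t - g t) ^+ 2)| <= d by near: n; move/cvgr0Pnorm_le : vg; exact.
  rewrite !ler_norml invr1 !mul1r => /andP[_ ?] /andP[_ ?]; lra.
have E n : \int[leb]_t (u n t * v n t) = \int[leb]_t (f t * g t) +
   (\int[leb]_t (g t * (u n t - f t)) + (\int[leb]_t (f t * (v n t - g t)) +
   \int[leb]_t ((u n t - f t) * (v n t - g t)))).
  have H1 := L2M Lg (Luf n); have H2 := L2M Lf (Lvg n); have H3 := L2M (Luf n) (Lvg n).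
  rewrite -(RintegralDT H2 H3) -(RintegralDT H1 (L1D H2 H3)).
  rewrite -(RintegralDT (L2M Lf Lg) (L1D H1 (L1D H2 H3))).
  by apply: eq_RintegralT => t; ring.
rewrite (_ : (fun n => _) = (fun n => \int[leb]_t (f t * g t) +
   (\int[leb]_t (g t * (u n t - f t)) + (\int[leb]_t (f t * (v n t - g t)) +
   \int[leb]_t ((u n t - f t) * (v n t - g t)))))); last by apply/funext => n; exact: E.
rewrite -[X in _ --> X]addr0; apply: cvgD; first exact: cvg_cst.
rewrite -[X in _ --> X]addr0; apply: cvgD => //.
by rewrite -[X in _ --> X]addr0; apply: cvgD.
Unshelve. all: by end_near. Qed.

Lemma cvg_add_unique (u v u' v' : nat -> R) (a b a' b' : R) :
  u n @[n --> \oo] --> a -> v n @[n --> \oo] --> b ->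
  u' n @[n --> \oo] --> a' -> v' n @[n --> \oo] --> b' ->
  (forall n, u n + v n = u' n + v' n) -> a + b = a' + b'.
Proof.
move=> ua vb ua' vb' E.
have c1 : u n + v n @[n --> \oo] --> a + b by exact: cvgD.
have c2 : u n + v n @[n --> \oo] --> a' + b' by under eq_fun do rewrite E; exact: cvgD.
exact: (cvg_unique _ c1 c2).
Qed.

(** The closure in L^2 of the graph of the pair transform; a relation, like [L2_extension], since
    the image is fixed only up to almost everywhere equality. *)
Definition pair_graph (s : R) x y X Y := [/\ L2 x, L2 y, L2 X, L2 Y &
  exists x_ y_ : nat -> R -> R, [/\ forall n, L12 (x_ n) /\ L12 (y_ n),
    L2_tends x_ x, L2_tends y_ y,
    L2_tends (fun n => pair_transform1 s (x_ n) (y_ n)) X &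
    L2_tends (fun n => pair_transform2 s (x_ n) (y_ n)) Y]].

(** The identity holds between the n-th terms of the two approximating sequences, however unrelated
    these are, and each of the four integrals converges. *)
Lemma pair_graph_Parseval s x y a b X Y A B : s ^+ 2 = 1 ->
  pair_graph s x y X Y -> pair_graph s a b A B ->
  \int[leb]_nu (X nu * A nu) + \int[leb]_nu (Y nu * B nu) =
  \int[leb]_t (x t * a t) + \int[leb]_t (y t * b t).
Proof.
move=> s2 [Lx Ly LX LY [x_ [y_ [Lxy cx cy cX cY]]]] [La Lb LA LB [a_ [b_ [Lab ca cb cA cB]]]].
have L1x n := (Lxy n).1; have L1y n := (Lxy n).2.
have L1a n := (Lab n).1; have L1b n := (Lab n).2.
apply: (cvg_add_unique
  (cvg_Rintegral_mul (fun n => L2_pair_transform1 s (L1x n) (L1y n))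
    (fun n => L2_pair_transform1 s (L1a n) (L1b n)) LX LA cX cA)
  (cvg_Rintegral_mul (fun n => L2_pair_transform2 s (L1x n) (L1y n))
    (fun n => L2_pair_transform2 s (L1a n) (L1b n)) LY LB cY cB)
  (cvg_Rintegral_mul (fun n => (L1x n).2) (fun n => (L1a n).2) Lx La cx ca)
  (cvg_Rintegral_mul (fun n => (L1y n).2) (fun n => (L1b n).2) Ly Lb cy cb)).
by move=> n; exact: pair_Parseval.
Qed.

Lemma pair_graph_adjoint s x y a b X Y A B :
  pair_graph s x y X Y -> pair_graph (- s) a b A B ->
  \int[leb]_t (X t * a t) + \int[leb]_t (Y t * b t) =
  \int[leb]_t (x t * A t) + \int[leb]_t (y t * B t).
Proof.
move=> [Lx Ly LX LY [x_ [y_ [Lxy cx cy cX cY]]]] [La Lb LA LB [a_ [b_ [Lab ca cb cA cB]]]].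
have L1x n := (Lxy n).1; have L1y n := (Lxy n).2.
have L1a n := (Lab n).1; have L1b n := (Lab n).2.
apply: (cvg_add_unique
  (cvg_Rintegral_mul (fun n => L2_pair_transform1 s (L1x n) (L1y n))
    (fun n => (L1a n).2) LX La cX ca)
  (cvg_Rintegral_mul (fun n => L2_pair_transform2 s (L1x n) (L1y n))
    (fun n => (L1b n).2) LY Lb cY cb)
  (cvg_Rintegral_mul (fun n => (L1x n).2)
    (fun n => L2_pair_transform1 (- s) (L1a n) (L1b n)) Lx LA cx cA)
  (cvg_Rintegral_mul (fun n => (L1y n).2)
    (fun n => L2_pair_transform2 (- s) (L1a n) (L1b n)) Ly LB cy cB)).
by move=> n; exact: pair_adjoint.
Qed.

End Parseval.

(** * The sign multiplier and the relations between a signal and its orthogonal signal *)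

Section HilbertPairs.
Variable R : realType.
Local Notation leb := (@lebesgue_measure R).

Lemma measurable_sgr : measurable_fun setT (@Num.sg R).
Proof.
rewrite (_ : @Num.sg R = fun x => \1_(`]0, +oo[%classic : set R) x - \1_(`]-oo, 0[%classic : set R) x).
  by apply: measurable_funB; exact: measurable_indic.
apply/funext => x; rewrite !indicE !mem_setE !in_itv/= andbT.
by case: sgrP => // _; rewrite ?subr0 ?sub0r.
Qed.

(** The sign of 0 is 0, so its square is 1 only off a null set. *)
Lemma Rintegral_sgM2 (f : R -> R) : measurable_fun setT f ->
  \int[leb]_x (Num.sg x ^+ 2 * f x) = \int[leb]_x f x.
Proof.
move=> mf; congr fine; apply: ae_eq_integral => //.
- apply/measurable_EFinP; apply: measurable_funM => //.
  by apply: measurable_funX; exact: measurable_sgr.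
- exact/measurable_EFinP.
exists [set 0]; split; [exact: measurable_set1|exact: lebesgue_measure_set1|].
move=> x /= nE; apply: contrapT => x0; apply: nE => _.
by rewrite sqr_sg (_ : (x != 0) = true) ?mul1r//; apply/eqP.
Qed.

(** The multiplier turns (X1, X2) into sign times (X2, - X1) and (Y1, Y2) into sign times (- Y2,
    Y1): opposite quarter turns. A pair is orthogonal to its own quarter turn, whence the two zeros;
    that the turns are opposite makes the two mixed pairings equal and puts the minus sign into the
    last relation. Each [cst 0] is a coordinate along mu or xi mu, which the signals lack. *)
Lemma hilbert_pair_relations (x y u v X1 X2 Y1 Y2 : R -> R) :
  pair_graph 1 x (cst 0) X1 X2 -> pair_graph 1 y (cst 0) Y1 Y2 ->
  pair_graph (- 1) (fun t => Num.sg t * X2 t) (fun t => - (Num.sg t * X1 t)) u (cst 0) ->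
  pair_graph (- 1) (fun t => - (Num.sg t * Y2 t)) (fun t => Num.sg t * Y1 t) v (cst 0) ->
  [/\ \int[leb]_t (x t * u t) = 0, \int[leb]_t (y t * v t) = 0,
      \int[leb]_t (y t * u t) = \int[leb]_t (x t * v t) &
      [/\ \int[leb]_t (x t * x t) = \int[leb]_t (u t * u t),
       \int[leb]_t (y t * y t) = \int[leb]_t (v t * v t) &
       \int[leb]_t (x t * y t) = - \int[leb]_t (u t * v t)]].
Proof.
set W1 := fun t => Num.sg t * X2 t; set W2 := fun t => - (Num.sg t * X1 t).
set W3 := fun t => - (Num.sg t * Y2 t); set W4 := fun t => Num.sg t * Y1 t.
move=> G1 G2 H1 H2.
have I0 : \int[leb]_t (0 : R) = 0 by rewrite Rintegral_cst// mul0r.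
have I00 (f : R -> R) : \int[leb]_t (f t * cst 0 t) = 0.
  by rewrite -[RHS]I0; apply: eq_RintegralT => t; rewrite mulr0.
have I000 (f : R -> R) : \int[leb]_t (cst 0 t * f t) = 0.
  by rewrite -[RHS]I0; apply: eq_RintegralT => t; rewrite mul0r.
have s1 : 1 ^+ 2 = 1 :> R by rewrite expr1n.
have s2 : (- 1) ^+ 2 = 1 :> R by rewrite sqrrN expr1n.
have [_ _ LX1 LX2 _] := G1; have [_ _ LY1 LY2 _] := G2.
have [LW1 LW2 _ _ _] := H1; have [LW3 LW4 _ _ _] := H2.
(* In Parseval's identity both factors carry a sign, which thus enters squared; [e] is the scalar
   that remains. *)
have sgI (f g F K : R -> R) (e : R) : L2 f -> L2 g ->
    (forall t, F t * K t = e * (Num.sg t ^+ 2 * (f t * g t))) ->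
    \int[leb]_t (F t * K t) = e * \int[leb]_t (f t * g t).
  move=> Lf Lg FK; have Lfg := L2M Lf Lg.
  rewrite (eq_RintegralT FK) RintegralZT.
    by rewrite (Rintegral_sgM2 (L1_measurable Lfg)).
  have := @L1Mbounded _ _ (fun t => Num.sg t ^+ 2) 1 Lfg.
  under [X in _ -> _ -> L1 X]eq_fun do rewrite mulrC; apply.
    by apply: measurable_funX; exact: measurable_sgr.
  by move=> t; rewrite normrX normr_sg; case: (t == 0); rewrite ?expr0n ?expr1n.
(* Each pairing in time becomes a pairing of spectra in which [Num.sg] occurs once. *)
have E11 := pair_graph_adjoint G1 H1; have E22 := pair_graph_adjoint G2 H2.
have E21 := pair_graph_adjoint G2 H1; have E12 := pair_graph_adjoint G1 H2.
have NM (f g : R -> R) : L2 f -> L2 g ->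
    \int[leb]_t (f t * - (Num.sg t * g t)) = - \int[leb]_t (g t * (Num.sg t * f t)).
  move=> Lf Lg; rewrite -RintegralNT; last first.
    apply: (L2M Lg); apply: (@L2Mbounded _ _ _ 1 Lf); first exact: measurable_sgr.
    by move=> t; rewrite normr_sg; case: (t == 0).
  by apply: eq_RintegralT => t; ring.
rewrite !I000 !addr0 in E11 E22 E21 E12.
rewrite (NM _ _ LX2 LX1) subrr in E11.
rewrite (NM _ _ LY1 LY2) addNr in E22.
rewrite (NM _ _ LY2 LX1) in E21.
rewrite (NM _ _ LX1 LY2) addrC in E12.
split; [exact: esym|exact: esym| |].
  rewrite -E21 -E12; congr (_ - _); apply: eq_RintegralT => t; rewrite ?/W1 ?/W4; ring.
have P11 := pair_graph_Parseval s1 G1 G1; have P22 := pair_graph_Parseval s1 G2 G2.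
have P12 := pair_graph_Parseval s1 G1 G2.
have Q11 := pair_graph_Parseval s2 H1 H1; have Q22 := pair_graph_Parseval s2 H2 H2.
have Q12 := pair_graph_Parseval s2 H1 H2.
rewrite !I000 !addr0 in P11 P22 P12 Q11 Q22 Q12.
split.
- rewrite -P11 Q11 (sgI X2 X2 W1 W1 1)//; last by move=> t; rewrite /W1; ring.
  rewrite (sgI X1 X1 W2 W2 1)//; last by move=> t; rewrite /W2; ring.
  by rewrite !mul1r addrC.
- rewrite -P22 Q22 (sgI Y2 Y2 W3 W3 1)//; last by move=> t; rewrite /W3; ring.
  rewrite (sgI Y1 Y1 W4 W4 1)//; last by move=> t; rewrite /W4; ring.
  by rewrite !mul1r addrC.
- rewrite -P12 Q12 (sgI X2 Y2 W1 W3 (- 1))//; last by move=> t; rewrite /W1 /W3; ring.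
  rewrite (sgI X1 Y1 W2 W4 (- 1))//; last by move=> t; rewrite /W2 /W4; ring.
  by rewrite !mulN1r -opprD opprK addrC.
Qed.

End HilbertPairs.

(** * Quaternion coordinates, and the quaternion Fourier transform as a pair transform *)

Section QuaternionCoordinates.
Variable R : realType.
Local Notation H := (quat R).
Local Notation leb := (@lebesgue_measure R).
Implicit Types (p q u v w mu xi : H) (f : R -> H).

Lemma quat_ext p q : qre p = qre q -> qi p = qi q -> qj p = qj q -> qk p = qk q -> p = q.
Proof. by case: p q => [a b c d] [a' b' c' d'] /= -> -> -> ->. Qed.

Lemma quat_coordE u q : quat_coord u q =
  qre u * qre q + qi u * qi q + qj u * qj q + qk u * qk q.
Proof. rewrite /quat_coord /=; ring. Qed.

Lemma quat_coordD u p q : quat_coord u (p + q) = quat_coord u p + quat_coord u q.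
Proof. rewrite !quat_coordE /=; ring. Qed.

Lemma quat_coordB u p q : quat_coord u (p - q) = quat_coord u p - quat_coord u q.
Proof. rewrite !quat_coordE /=; ring. Qed.

Lemma quat_coordZ a u q : quat_coord u (a *: q) = a * quat_coord u q.
Proof. rewrite !quat_coordE /=; ring. Qed.

Lemma quat_coordN u q : quat_coord (- u) q = - quat_coord u q.
Proof. rewrite !quat_coordE /=; ring. Qed.

(** [quat_coord] is the Euclidean inner product of R^4, for which multiplication by the conjugate is
    the adjoint of multiplication. *)
Lemma quat_coord_mull u p q : quat_coord u (p * q) = quat_coord (quat_conj p * u) q.
Proof. rewrite !quat_coordE /=; ring. Qed.

Lemma quat_coord_mulr u p q : quat_coord u (p * q) = quat_coord (u * quat_conj q) p.
Proof. rewrite !quat_coordE /=; ring. Qed.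

Definition quat_nsq q := qre q ^+ 2 + qi q ^+ 2 + qj q ^+ 2 + qk q ^+ 2.

Lemma quat_nsq_ge0 q : 0 <= quat_nsq q.
Proof. by rewrite !addr_ge0 ?sqr_ge0. Qed.

Lemma quat_norm_sqr q : quat_norm q ^+ 2 = quat_nsq q.
Proof. by rewrite sqr_sqrtr// quat_nsq_ge0. Qed.

Lemma quat_nsqM p q : quat_nsq (p * q) = quat_nsq p * quat_nsq q.
Proof. rewrite /quat_nsq /=; ring. Qed.

(* Cauchy-Schwarz: u q^* has modulus |q| and scalar part the coordinate. *)
Lemma quat_coord_sqr_le u q : quat_nsq u = 1 -> quat_coord u q ^+ 2 <= quat_nsq q.
Proof.
move=> u1; have -> : quat_nsq q = quat_nsq (quat_conj u * q).
  rewrite quat_nsqM (_ : quat_nsq (quat_conj u) = quat_nsq u) ?u1 ?mul1r//.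
  by rewrite /quat_nsq /= !sqrrN.
by rewrite /quat_coord /quat_nsq -!addrA lerDl !addr_ge0 ?sqr_ge0.
Qed.

Section UnitPure.
Variable mu : H.
Hypothesis mu1 : unit_pure mu.

Lemma unit_pure_nsq : quat_nsq mu = 1.
Proof. by rewrite -quat_norm_sqr mu1.1 expr1n. Qed.

Lemma unit_pure_conj : quat_conj mu = - mu.
Proof. by apply: quat_ext => //=; rewrite mu1.2 oppr0. Qed.

Lemma unit_pure_sqr : mu * mu = - 1.
Proof.
have := unit_pure_nsq; rewrite /quat_nsq mu1.2 expr0n add0r => E.
apply: quat_ext => /=; rewrite mu1.2.
- by rewrite -E; ring.
- ring.
- ring.
- ring.
Qed.

Lemma quat_coord_mul_exp u q (th : R) :
  quat_coord u (q * quat_exp mu th) =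
  cos th * quat_coord u q - sin th * quat_coord (u * mu) q.
Proof.
rewrite /quat_exp mulrDr quat_coordD -!scalerAr !quat_coordZ mulr1.
by rewrite quat_coord_mulr unit_pure_conj mulrN quat_coordN mulrN.
Qed.

End UnitPure.

(** For pure quaternions the vector part of the product is the cross product, which is
    antisymmetric; the scalar part is symmetric, but 0 by orthogonality. *)
Lemma basis_anticomm xi mu : quaternion_basis xi mu -> mu * xi = - (xi * mu).
Proof.
case=> [[_ xi0] [_ mu0] /= d0]; apply: quat_ext => /=; move: d0; rewrite xi0 mu0.
- move=> d0; have -> : 0 * 0 - qi mu * qi xi - qj mu * qj xi - qk mu * qk xi =
    0 * 0 - qi xi * qi mu - qj xi * qj mu - qk xi * qk mu by ring.
  by rewrite d0 oppr0.
- by move=> _; ring.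
- by move=> _; ring.
- by move=> _; ring.
Qed.

Lemma quat_Lfun1_coord f u : quat_Lfun 1%:E f -> L1 (fun t => quat_coord u (f t)).
Proof.
case=> /Lfun1_integrable h0 /Lfun1_integrable h1 /Lfun1_integrable h2 /Lfun1_integrable h3.
have := L1D (L1D (L1D (L1Z (qre u) h0) (L1Z (qi u) h1)) (L1Z (qj u) h2)) (L1Z (qk u) h3).
by congr L1; apply/funext => t; rewrite quat_coordE.
Qed.

Lemma quat_Lfun2_coord f u : quat_Lfun 2%:E f -> L2 (fun t => quat_coord u (f t)).
Proof.
case=> /L2_Lfun h0 /L2_Lfun h1 /L2_Lfun h2 /L2_Lfun h3.
have := L2D (L2D (L2D (L2Z (qre u) h0) (L2Z (qi u) h1)) (L2Z (qj u) h2)) (L2Z (qk u) h3).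
by congr L2; apply/funext => t; rewrite quat_coordE.
Qed.

Lemma quat_coord_integral f u :
  L1 (fun t => qre (f t)) -> L1 (fun t => qi (f t)) ->
  L1 (fun t => qj (f t)) -> L1 (fun t => qk (f t)) ->
  quat_coord u (quat_integral f) = \int[leb]_t quat_coord u (f t).
Proof.
move=> h0 h1 h2 h3; rewrite quat_coordE /=.
have k0 := L1Z (qre u) h0; have k1 := L1Z (qi u) h1.
have k2 := L1Z (qj u) h2; have k3 := L1Z (qk u) h3.
rewrite -(RintegralZT _ h0) -(RintegralZT _ h1) -(RintegralZT _ h2) -(RintegralZT _ h3).
rewrite -(RintegralDT k0 k1) -(RintegralDT (L1D k0 k1) k2).
rewrite -(RintegralDT (L1D (L1D k0 k1) k2) k3).
by apply: eq_RintegralT => t; rewrite quat_coordE.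
Qed.

(** The integral of a nonnegative function is the supremum over the simple functions below it, hence
    monotone for arbitrary functions, such as those that [L2_cvg] integrates. *)
Lemma ge0_le_integral_nonmeasurable (f g : R -> \bar R) :
  (forall x, 0 <= f x)%E -> (forall x, f x <= g x)%E ->
  (\int[leb]_x f x <= \int[leb]_x g x)%E.
Proof.
move=> f0 fg; rewrite !ge0_integralTE//; last by move=> x; exact: le_trans (f0 x) (fg x).
apply: le_ereal_sup => _ [h hf <-]; exists h => // x.
exact: le_trans (hf x) (fg x).
Qed.

Lemma eq_L2_tends (u v : nat -> R -> R) (f : R -> R) : (forall n, u n =1 v n) ->
  L2_tends u f -> L2_tends v f.
Proof. by move=> uv; have -> : u = v by apply/funext => n; exact/funext. Qed.

Lemma L2_cvg_coord (f_ : nat -> R -> H) f u : quat_nsq u = 1 -> L2_cvg f_ f ->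
  L2_tends (fun n t => quat_coord u (f_ n t)) (fun t => quat_coord u (f t)).
Proof.
move=> u1 ff; apply: (squeeze_cvge _ (cvg_cst 0%E) ff).
apply: nearW => n; apply/andP; split.
  by apply: integral_ge0 => x _; rewrite lee_fin sqr_ge0.
apply: ge0_le_integral_nonmeasurable => x; rewrite lee_fin ?sqr_ge0//.
by rewrite -quat_coordB quat_norm_sqr quat_coord_sqr_le.
Qed.

Definition quat_transform (s : R) mu (z : R -> H) (nu : R) : H :=
  quat_integral (fun t => z t * quat_exp mu (- (s * (2 * pi * nu * t)))).

Lemma qft_intE mu : qft_int mu = quat_transform 1 mu.
Proof.
apply/funext => z; apply/funext => nu; congr quat_integral; apply/funext => t.
by rewrite mul1r.
Qed.

Lemma iqft_intE mu : iqft_int mu = quat_transform (- 1) mu.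
Proof.
apply/funext => z; apply/funext => nu; congr quat_integral; apply/funext => t.
by congr (_ * quat_exp _ _); rewrite mulN1r opprK mulrAC.
Qed.

Section PairOfCoordinates.
Variables (s : R) (mu : H).
Hypotheses (s1 : s = 1 \/ s = - 1) (mu1 : unit_pure mu).

Let cosE x : cos (- (s * x)) = cos x.
Proof. by case: s1 => ->; rewrite ?mulN1r ?mul1r ?opprK ?cosN. Qed.

Let sinE x : sin (- (s * x)) = - (s * sin x).
Proof. by case: s1 => ->; rewrite ?mulN1r ?mul1r ?opprK ?sinN. Qed.

Lemma coord_kernel (z : R -> H) u nu t :
  quat_coord u (z t * quat_exp mu (- (s * (2 * pi * nu * t)))) =
  quat_coord u (z t) * cos (2 * pi * nu * t) +
  s * (quat_coord (u * mu) (z t) * sin (2 * pi * nu * t)).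
Proof. by rewrite (quat_coord_mul_exp mu1) cosE sinE; ring. Qed.

Let L1cos (h : R -> R) nu : L1 h -> L1 (fun t => h t * cos (2 * pi * nu * t)).
Proof.
move=> Lh; apply: L1_trig => //; last exact: cos_max.
by apply: continuous_measurable_fun; exact: continuous_cos.
Qed.

Let L1sin (h : R -> R) nu : L1 h -> L1 (fun t => h t * sin (2 * pi * nu * t)).
Proof.
move=> Lh; apply: L1_trig => //; last exact: sin_max.
by apply: continuous_measurable_fun; exact: continuous_sin.
Qed.

Lemma coord_quat_transform (z : R -> H) u nu : quat_Lfun 1%:E z ->
  quat_coord u (quat_transform s mu z nu) =
  pair_transform1 s (fun t => quat_coord u (z t)) (fun t => quat_coord (u * mu) (z t)) nu.
Proof.
move=> Lz; have Lc v := quat_Lfun1_coord v Lz.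
have LK v : L1 (fun t => quat_coord v (z t * quat_exp mu (- (s * (2 * pi * nu * t))))).
  have := L1D (L1cos nu (Lc v)) (L1Z s (L1sin nu (Lc (v * mu)))).
  by congr L1; apply/funext => t; rewrite coord_kernel.
(* The four components are coordinates along the standard basis, so [LK] supplies the integrability
   that [quat_coord_integral] asks for. *)
have e0 q : qre q = quat_coord (Quat 1 0 0 0) q by rewrite quat_coordE /=; ring.
have e1 q : qi q = quat_coord (Quat 0 1 0 0) q by rewrite quat_coordE /=; ring.
have e2 q : qj q = quat_coord (Quat 0 0 1 0) q by rewrite quat_coordE /=; ring.
have e3 q : qk q = quat_coord (Quat 0 0 0 1) q by rewrite quat_coordE /=; ring.
rewrite /quat_transform quat_coord_integral.
- rewrite /pair_transform1 /cos_transform /sin_transform /trig_transform.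
  rewrite -(RintegralZT s (L1sin nu (Lc (u * mu)))).
  rewrite -(RintegralDT (L1cos nu (Lc u)) (L1Z s (L1sin nu (Lc (u * mu))))).
  by apply: eq_RintegralT => t; exact: coord_kernel.
- by have := LK (Quat 1 0 0 0); congr L1; apply/funext => t; rewrite -e0.
- by have := LK (Quat 0 1 0 0); congr L1; apply/funext => t; rewrite -e1.
- by have := LK (Quat 0 0 1 0); congr L1; apply/funext => t; rewrite -e2.
- by have := LK (Quat 0 0 0 1); congr L1; apply/funext => t; rewrite -e3.
Qed.

(** This is [coord_quat_transform] at [u * mu], with u mu mu = - u. *)
Lemma coord2_quat_transform (z : R -> H) u nu : quat_Lfun 1%:E z ->
  quat_coord (u * mu) (quat_transform s mu z nu) =
  pair_transform2 s (fun t => quat_coord u (z t)) (fun t => quat_coord (u * mu) (z t)) nu.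
Proof.
move=> Lz; rewrite coord_quat_transform// /pair_transform1 /pair_transform2; congr (_ + _).
rewrite -mulrN; congr (s * _); rewrite -RintegralNT; last first.
  exact: L1sin (quat_Lfun1_coord u Lz).
apply: eq_RintegralT => t.
by rewrite -mulrA unit_pure_sqr// mulrN1 quat_coordN mulNr.
Qed.

(** Along a unit quaternion the coordinate does not increase L^2 distances, so the coordinates of
    one quaternion sequence, and of its transforms, approximate those of the limits. *)
Lemma pair_graph_coord f g u : quat_nsq u = 1 -> L2_extension (quat_transform s mu) f g ->
  pair_graph s (fun t => quat_coord u (f t)) (fun t => quat_coord (u * mu) (f t))
    (fun t => quat_coord u (g t)) (fun t => quat_coord (u * mu) (g t)).
Proof.
move=> u1 [Lf Lg [f_ [Lf_ ff Ff]]].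
have um1 : quat_nsq (u * mu) = 1 by rewrite quat_nsqM u1 unit_pure_nsq// mulr1.
split; try exact: quat_Lfun2_coord.
exists (fun n t => quat_coord u (f_ n t)), (fun n t => quat_coord (u * mu) (f_ n t)); split.
- move=> n; have [h1 h2] := Lf_ n.
  by split; split; [exact: quat_Lfun1_coord|exact: quat_Lfun2_coord|
    exact: quat_Lfun1_coord|exact: quat_Lfun2_coord].
- exact: L2_cvg_coord.
- exact: L2_cvg_coord.
- apply: eq_L2_tends (L2_cvg_coord u1 Ff) => n nu.
  by rewrite coord_quat_transform//; case: (Lf_ n).
- apply: eq_L2_tends (L2_cvg_coord um1 Ff) => n nu.
  by rewrite coord2_quat_transform//; case: (Lf_ n).
Qed.

End PairOfCoordinates.

End QuaternionCoordinates.

Lemma complex_signal_coord (R : realType) (xi mu : quat R) (x y : R -> R) t :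
  quaternion_basis xi mu ->
  [/\ quat_coord 1 (complex_signal xi x y t) = x t,
      quat_coord xi (complex_signal xi x y t) = y t,
      quat_coord mu (complex_signal xi x y t) = 0 &
      quat_coord (xi * mu) (complex_signal xi x y t) = 0].
Proof.
move=> [xi1 mu1 d0].
have re_xi := xi1.2; have re_mu := mu1.2.
have nxi := unit_pure_nsq xi1.
rewrite /quat_nsq re_xi expr0n add0r in nxi.
have {}d0 : qi xi * qi mu + qj xi * qj mu + qk xi * qk mu = 0.
  by move: d0; rewrite /= re_xi re_mu => d0; apply/eqP; rewrite -oppr_eq0 -d0; apply/eqP; ring.
split; rewrite /complex_signal quat_coordE /= re_xi ?re_mu.
- ring.
- transitivity ((qi xi ^+ 2 + qj xi ^+ 2 + qk xi ^+ 2) * y t); first by ring.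
  by rewrite nxi mul1r.
- transitivity ((qi xi * qi mu + qj xi * qj mu + qk xi * qk mu) * y t); first by ring.
  by rewrite d0 mul0r.
- transitivity (- (qi xi * qi mu + qj xi * qj mu + qk xi * qk mu) * x t); first by ring.
  by rewrite d0 oppr0 mul0r.
Qed.

Lemma complex_signal_mul_coord (R : realType) (xi mu : quat R) (x y : R -> R) t :
  quaternion_basis xi mu ->
  quat_coord (mu * xi) (complex_signal xi x y t) = 0.
Proof.
by move=> b; rewrite (basis_anticomm b) quat_coordN; have [_ _ _ ->] := complex_signal_coord x y t b; rewrite oppr0.
Qed.

(** * The hyperanalytic signal and its covariance matrix *)

Section Hyperanalytic.
Variables (R : realType) (xi mu : quat R) (zr zi o_r o_i : R -> R) (h : R -> quat R).
Hypothesis b : quaternion_basis xi mu.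
Local Notation leb := (@lebesgue_measure R).
Let z := (complex_signal xi zr zi).
Let o := (complex_signal xi o_r o_i).

(** The coordinate of mu o along u is minus that of o along mu u; as [z] and [o] have no component
    along mu and mu xi, one term is left in each case. *)
Lemma hyperanalytic_coord t : h t = z t + mu * o t ->
  [/\ quat_coord 1 (h t) = zr t, quat_coord xi (h t) = zi t,
      quat_coord mu (h t) = o_r t & quat_coord (mu * xi) (h t) = o_i t].
Proof.
have [xi1 mu1 d0] := b.
have [z0 z1 z2 z3] := complex_signal_coord zr zi t b.
have [w0 w1 w2 w3] := complex_signal_coord o_r o_i t b.
move=> hE; have M u : quat_coord u (h t) = quat_coord u (z t) - quat_coord (mu * u) (o t).
  by rewrite hE quat_coordD quat_coord_mull unit_pure_conj// mulNr quat_coordN.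
split; rewrite M.
- by rewrite mulr1 z0 w2 subr0.
- by rewrite z1 complex_signal_mul_coord// subr0.
- by rewrite unit_pure_sqr// quat_coordN opprK z2 w0 add0r.
- by rewrite mulrA unit_pure_sqr// mulN1r quat_coordN opprK w1 complex_signal_mul_coord// add0r.
Qed.

Lemma orthogonal_signal_relations : is_orthogonal_signal mu z o ->
  [/\ \int[leb]_t (zr t * o_r t) = 0, \int[leb]_t (zi t * o_i t) = 0,
      \int[leb]_t (zi t * o_r t) = \int[leb]_t (zr t * o_i t) &
      [/\ \int[leb]_t (zr t * zr t) = \int[leb]_t (o_r t * o_r t),
       \int[leb]_t (zi t * zi t) = \int[leb]_t (o_i t * o_i t) &
       \int[leb]_t (zr t * zi t) = - \int[leb]_t (o_r t * o_i t)]].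
Proof.
have [xi1 mu1 d0] := b.
case=> Z [zZ Wo].
rewrite /is_qft qft_intE /z in zZ; rewrite /is_iqft iqft_intE /o in Wo.
have n1 : quat_nsq (1 : quat R) = 1 by rewrite /quat_nsq /= expr1n !expr0n !addr0.
have nxi := unit_pure_nsq xi1.
(* The plane of 1 and mu comes from u = 1, that of xi and xi mu from u = xi. *)
have G1 := pair_graph_coord (or_introl erefl) mu1 n1 zZ.
have G2 := pair_graph_coord (or_introl erefl) mu1 nxi zZ.
have H1 := pair_graph_coord (or_intror erefl) mu1 n1 Wo.
have H2 := pair_graph_coord (or_intror erefl) mu1 nxi Wo.
have c0 (x y : R -> R) : (fun t => quat_coord 1 (complex_signal xi x y t)) = x.
  by apply/funext => t; case: (complex_signal_coord x y t b).
have c1 (x y : R -> R) : (fun t => quat_coord xi (complex_signal xi x y t)) = y.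
  by apply/funext => t; case: (complex_signal_coord x y t b).
have c2 (x y : R -> R) : (fun t => quat_coord mu (complex_signal xi x y t)) = cst 0.
  by apply/funext => t; case: (complex_signal_coord x y t b).
have c3 (x y : R -> R) : (fun t => quat_coord (xi * mu) (complex_signal xi x y t)) = cst 0.
  by apply/funext => t; case: (complex_signal_coord x y t b).
rewrite !mul1r !c0 !c2 in G1 H1; rewrite !c1 !c3 in G2 H2.
(* The conjugate of - mu is mu, so the coordinate of - mu Z along u is that of Z along mu u. *)
have W u : (fun t => quat_coord u (Num.sg t *: (- mu * Z t))) =
    (fun t => Num.sg t * quat_coord (mu * u) (Z t)).
  apply/funext => t; rewrite quat_coordZ quat_coord_mull; congr (_ * quat_coord (_ * u) _).
  by apply: quat_ext => //=; rewrite ?opprK// mu1.2 oppr0.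
rewrite !W mulr1 unit_pure_sqr// in H1.
(* Here mu xi = - xi mu and mu xi mu = xi, against mu 1 = mu and mu mu = - 1 in the other plane:
   this is the source of the opposite quarter turns. *)
rewrite !W mulrA (basis_anticomm b) mulNr -mulrA unit_pure_sqr// mulrN1 opprK in H2.
have N (a : R -> R) u : (fun t => a t * quat_coord (- u) (Z t)) =
    (fun t => - (a t * quat_coord u (Z t))).
  by apply/funext => t; rewrite quat_coordN mulrN.
rewrite N in H1; rewrite N in H2.
exact: (hilbert_pair_relations G1 G2 H1 H2).
Qed.

End Hyperanalytic.

Theorem mainTheorem4 (R : realType) (xi mu : quat R)
    (zr zi o_r o_i : R -> R) (h : R -> quat R)
    (basis_xi_mu : quaternion_basis xi mu)
    (L2_zr : zr \in Lfun (@lebesgue_measure R) 2%:E)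
    (L2_zi : zi \in Lfun (@lebesgue_measure R) 2%:E)
    (z_improper : ~ proper_signal zr zi)
    (h_hyperanalytic : is_hyperanalytic_signal mu
       (complex_signal xi zr zi) (complex_signal xi o_r o_i) h) :
  let alpha := \int[@lebesgue_measure R]_t (zr t ^+ 2) in
  let omega := \int[@lebesgue_measure R]_t (zi t ^+ 2) in
  let beta := \int[@lebesgue_measure R]_t (zi t * o_r t) in
  let gamma := \int[@lebesgue_measure R]_t (zr t * zi t) in
  Cmu_proper xi mu h /\
  covariance_mx xi mu h = Cmu_pattern alpha beta gamma omega /\
  [/\ alpha = \int[@lebesgue_measure R]_t (o_r t ^+ 2),
      omega = \int[@lebesgue_measure R]_t (o_i t ^+ 2),
      beta = \int[@lebesgue_measure R]_t (zr t * o_i t) &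
      gamma = - \int[@lebesgue_measure R]_t (o_r t * o_i t)].
Proof.
have [_ h_E] := h_hyperanalytic.
have [rO iO ri [rr ii ro]] := orthogonal_signal_relations basis_xi_mu h_hyperanalytic.1.
move=> alpha omega beta gamma.
have sqrE (f : R -> R) : \int[@lebesgue_measure R]_t (f t ^+ 2) =
    \int[@lebesgue_measure R]_t (f t * f t) by apply: eq_RintegralT => t; rewrite expr2.
have mulC (f g : R -> R) : \int[@lebesgue_measure R]_t (f t * g t) =
    \int[@lebesgue_measure R]_t (g t * f t) by apply: eq_RintegralT => t; rewrite mulrC.
have rel : [/\ alpha = \int[@lebesgue_measure R]_t (o_r t ^+ 2),
      omega = \int[@lebesgue_measure R]_t (o_i t ^+ 2),
      beta = \int[@lebesgue_measure R]_t (zr t * o_i t) &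
      gamma = - \int[@lebesgue_measure R]_t (o_r t * o_i t)].
  by split; rewrite /alpha /omega ?sqrE.
have cov : covariance_mx xi mu h = Cmu_pattern alpha beta gamma omega.
  have [ha hw hb hg] := rel.
  pose c (i : 'I_4) := tnth [tuple zr; zi; o_r; o_i] i.
  have hc (i : 'I_4) t : quat_coord (tnth [tuple 1; xi; mu; mu * xi] i) (h t) = c i t.
    have [h0 h1 h2 h3] := hyperanalytic_coord basis_xi_mu (h_E t).
    rewrite /c; case: i => -[|[|[|[|//]]]] i4; rewrite !(tnth_nth 0) ?(tnth_nth zr) //=.
  apply/matrixP => i j; rewrite !mxE.
  rewrite (_ : \int[_]_t _ = \int[@lebesgue_measure R]_t (c i t * c j t)); last first.
    by apply: eq_RintegralT => t; rewrite !hc.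
  (* [zr] is merely the default value of [nth], out of reach for indices below 4. *)
  rewrite /c !(tnth_nth zr).
  have ro' : \int[@lebesgue_measure R]_t (o_r t * o_i t) = - gamma by rewrite hg opprK.
  (* Of the sixteen entries, those on and above the diagonal are definitions or relations already
     proved; those below follow by commutativity of the product. *)
  case: i j => -[|[|[|[|//]]]] i4 [[|[|[|[|//]]]] j4] /=;
    first [by rewrite -sqrE | by rewrite -sqrE -ha | by rewrite -sqrE -hw
      | by [] | by rewrite mulC | by rewrite rO | by rewrite iO
      | by rewrite mulC rO | by rewrite mulC iO | by rewrite -hb
      | by rewrite mulC -hb | by rewrite ro' | by rewrite mulC ro'].
by split; [exists alpha, beta, gamma, omega|split].
Qed.
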